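(* Let $k\ge 1$ be an integer and let $BS(1,k)=\langle a,b \mid b^{-1}ab=a^k\rangle$. Then: (i) There is an algorithm that, given a quadratic equation with constants in $BS(1,k)$, decides whether or not the equation has a solution in $BS(1,k)$. (ii) There is an algorithm that, given a finite system of equations without coefficients, decides whether or not the system has a non-trivial solution in $BS(1,k)$.
   Context: An equation with constants (coefficients) in a group $G$ generated by a finite set $S$ is an expression $w(\bar x,S)=1$, where $w$ is a group word in finitely many variables $\bar x=(x_1,\dots,x_m)$ and the generators $S$ (here $S=\{a,b\}$). A solution in $G$ is an assignment of elements of $G$ to the variables which makes $w$ equal to $1$ in $G$. A system is solved by an assignment that solves all of its equations. An equation is quadratic if each variable occurring in it occurs exactly twice, counting occurrences as $x$ and as $x^{-1}$. A system is without coefficients (coefficient-free) if every equation has the form $w(\bar x)=1$ with $w$ a group word in the variables only. A solution of such a system is non-trivial if at least one variable is assigned a non-identity element. *)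

(* Defs.v *)
From HB Require Import structures.
From mathcomp Require Import all_boot.
From mathcomp Require Import boolp.

Set Implicit Arguments.
Unset Strict Implicit.
Unset Printing Implicit Defensive.

(* Recursive functions, in the textbook form with minimization restricted to  *)
(* regular functions: this yields exactly the total recursive functions.      *)
(* The clauses characterize the new function pointwise, so the class is       *)
(* closed under extensional equality by construction.                         *)
Inductive recursive : forall n : nat, (n.-tuple nat -> nat) -> Prop :=
| recursive_zero n f of
    (forall v, f v = 0) : @recursive n f
| recursive_succ f of
    (forall x, f [tuple x] = x.+1) : @recursive 1 f
| recursive_proj n (i : 'I_n) f of
    (forall v, f v = tnth v i) : @recursive n f
| recursive_comp m n (h : m.-tuple nat -> nat)
    (g : 'I_m -> n.-tuple nat -> nat) f of
    recursive h & (forall i, recursive (g i)) &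
    (forall v, f v = h [tuple g i v | i < m]) : @recursive n f
| recursive_primrec n (g : n.-tuple nat -> nat) (h : n.+2.-tuple nat -> nat) f of
    recursive g & recursive h &
    (forall v : n.-tuple nat, f [tuple of 0 :: v] = g v) &
    (forall x (v : n.-tuple nat),
       f [tuple of x.+1 :: v] = h [tuple of x :: f [tuple of x :: v] :: v]) :
    @recursive n.+1 f
| recursive_mu n (g : n.+1.-tuple nat -> nat) f of
    recursive g &
    (forall v : n.-tuple nat, g [tuple of f v :: v] = 0) &
    (forall (v : n.-tuple nat) y, y < f v -> g [tuple of y :: v] <> 0) :
    @recursive n f.

(* There is an algorithm that, given i in D (through its Goedel number        *)
(* enc i), decides whether P i holds.                                         *)
Definition algorithmically_decidable (I : Type) (enc : I -> nat)
    (D P : I -> Prop) : Prop :=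
  exists2 f : 1.-tuple nat -> nat, recursive f &
    forall i, D i ->
      (P i -> f [tuple enc i] = 1) /\ (~ P i -> f [tuple enc i] = 0).

(* Group words, not necessarily reduced: (x, false) stands for x and          *)
(* (x, true) for x^-1.                                                        *)
Definition gword (T : Type) := seq (T * bool).

Definition linv (T : Type) (l : T * bool) : T * bool := (l.1, ~~ l.2).

Definition winv (T : Type) (w : gword T) : gword T := rev (map (@linv T) w).

Definition weval (G : groupType) (T : Type) (s : T -> G) (w : gword T) : G :=
  (\prod_(l <- w) (if l.2 then (s l.1)^-1 else s l.1))%g.

(* The group < T | u = v for R u v >, as the quotient of the words by the     *)
(* least congruence making formal inverses inverse and satisfying R.          *)
Inductive pres_eq (T : Type) (R : gword T -> gword T -> Prop) :
    gword T -> gword T -> Prop :=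
| pres_refl u : pres_eq R u u
| pres_sym u v of pres_eq R u v : pres_eq R v u
| pres_trans u v w of pres_eq R u v & pres_eq R v w : pres_eq R u w
| pres_cat u u' v v' of pres_eq R u u' & pres_eq R v v' :
    pres_eq R (u ++ v) (u' ++ v')
| pres_cancel l : pres_eq R [:: l; linv l] [::]
| pres_rel u v of R u v : pres_eq R u v.

Definition pres_eqb (T : Type) (R : gword T -> gword T -> Prop) :
  rel (gword T) := fun u v => `[< pres_eq R u v >].

Lemma pres_eqb_refl T R : reflexive (@pres_eqb T R).
Proof. by move=> u; apply/asboolP; exact: pres_refl. Qed.

Lemma pres_eqb_sym T R : symmetric (@pres_eqb T R).
Proof. by move=> u v; apply/asboolP/asboolP; exact: pres_sym. Qed.

Lemma pres_eqb_trans T R : transitive (@pres_eqb T R).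
Proof.
move=> v u w /asboolP uv /asboolP vw; apply/asboolP; exact: pres_trans uv vw.
Qed.

Canonical pres_equiv (T : choiceType) (R : gword T -> gword T -> Prop) :=
  EquivRel (@pres_eqb T R) (@pres_eqb_refl T R) (@pres_eqb_sym T R)
    (@pres_eqb_trans T R).

Lemma linvK T : involutive (@linv T).
Proof. by case=> x b; rewrite /linv /= negbK. Qed.

Lemma winvK T : involutive (@winv T).
Proof.
move=> w; rewrite /winv map_rev revK -map_comp -[RHS]map_id.
by apply: eq_map => l; exact: linvK.
Qed.

Lemma pres_mulwV T R (w : gword T) : pres_eq R (w ++ winv w) [::].
Proof.
elim: w => [|l w IHw]; first exact: pres_refl.
have -> : (l :: w) ++ winv (l :: w) = [:: l] ++ (w ++ winv w) ++ [:: linv l].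
  by rewrite /winv map_cons rev_cons -cats1 /= catA.
apply: pres_trans (pres_cancel R l).
apply: (@pres_cat _ _ [:: l] [:: l] _ [:: linv l]); first exact: pres_refl.
exact: (@pres_cat _ _ _ [::] _ _ IHw (pres_refl _ _)).
Qed.

Lemma pres_mulVw T R (w : gword T) : pres_eq R (winv w ++ w) [::].
Proof. by rewrite -{2}(winvK w); exact: pres_mulwV. Qed.

Lemma pres_winv T R (u v : gword T) :
  pres_eq R u v -> pres_eq R (winv u) (winv v).
Proof.
move=> uv; apply: (@pres_trans _ _ _ (winv u ++ (v ++ winv v))).
  rewrite -{1}(cats0 (winv u)); apply: pres_cat; first exact: pres_refl.
  exact/pres_sym/pres_mulwV.
rewrite catA; apply: (@pres_cat _ _ _ [::]); last exact: pres_refl.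
apply: pres_trans (pres_mulVw R u).
by apply: pres_cat; [exact: pres_refl | exact: pres_sym].
Qed.

Local Open Scope quotient_scope.

Definition presented (T : choiceType) (R : gword T -> gword T -> Prop) :=
  {eq_quot (pres_equiv R)}.

HB.instance Definition _ (T : choiceType) (R : gword T -> gword T -> Prop) :=
  Choice.on (presented R).
HB.instance Definition _ (T : choiceType) (R : gword T -> gword T -> Prop) :=
  EqQuotient.on (presented R).

Definition pres_class (T : choiceType) (R : gword T -> gword T -> Prop)
  (w : gword T) : presented R := \pi w.

Definition pres_one (T : choiceType) (R : gword T -> gword T -> Prop) :
  presented R := pres_class R [::].

Definition pres_mul (T : choiceType) (R : gword T -> gword T -> Prop)
  (x y : presented R) : presented R := pres_class R (repr x ++ repr y).

Definition pres_inv (T : choiceType) (R : gword T -> gword T -> Prop)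
  (x : presented R) : presented R := pres_class R (winv (repr x)).

Lemma pres_classP (T : choiceType) (R : gword T -> gword T -> Prop) u v :
  pres_class R u = pres_class R v <-> pres_eq R u v.
Proof. by split=> [/eqmodP/asboolP|uv]; last apply/eqmodP/asboolP. Qed.

Lemma pres_class_repr (T : choiceType) (R : gword T -> gword T -> Prop)
  (x : presented R) : pres_class R (repr x) = x.
Proof. exact: reprK. Qed.

Lemma pres_repr_class (T : choiceType) (R : gword T -> gword T -> Prop) u :
  pres_eq R (repr (pres_class R u)) u.
Proof. by apply/pres_classP; exact: pres_class_repr. Qed.

Lemma pres_classM (T : choiceType) (R : gword T -> gword T -> Prop) u v :
  pres_mul (pres_class R u) (pres_class R v) = pres_class R (u ++ v).
Proof. by apply/pres_classP; apply: pres_cat; exact: pres_repr_class. Qed.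

Lemma pres_classV (T : choiceType) (R : gword T -> gword T -> Prop) u :
  pres_inv (pres_class R u) = pres_class R (winv u).
Proof. by apply/pres_classP; apply: pres_winv; exact: pres_repr_class. Qed.

Lemma pres_mulA (T : choiceType) (R : gword T -> gword T -> Prop) :
  associative (@pres_mul T R).
Proof.
move=> x y z; rewrite -(pres_class_repr x) -(pres_class_repr y).
by rewrite -(pres_class_repr z) !pres_classM catA.
Qed.

Lemma pres_1mul (T : choiceType) (R : gword T -> gword T -> Prop) :
  left_id (pres_one R) (@pres_mul T R).
Proof. by move=> x; rewrite -(pres_class_repr x) pres_classM. Qed.

Lemma pres_mul1 (T : choiceType) (R : gword T -> gword T -> Prop) :
  right_id (pres_one R) (@pres_mul T R).
Proof. by move=> x; rewrite -(pres_class_repr x) pres_classM cats0. Qed.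

Lemma pres_Vmul (T : choiceType) (R : gword T -> gword T -> Prop) :
  left_inverse (pres_one R) (@pres_inv T R) (@pres_mul T R).
Proof.
move=> x; rewrite -(pres_class_repr x) pres_classV pres_classM.
by apply/pres_classP; exact: pres_mulVw.
Qed.

Lemma pres_mulV (T : choiceType) (R : gword T -> gword T -> Prop) :
  right_inverse (pres_one R) (@pres_inv T R) (@pres_mul T R).
Proof.
move=> x; rewrite -(pres_class_repr x) pres_classV pres_classM.
by apply/pres_classP; exact: pres_mulwV.
Qed.

HB.instance Definition _ (T : choiceType) (R : gword T -> gword T -> Prop) :=
  isGroup.Build (presented R) (@pres_mulA T R) (@pres_1mul T R)
    (@pres_mul1 T R) (@pres_Vmul T R) (@pres_mulV T R).

Inductive bs_gen := gen_a | gen_b.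

Definition bool_of_bs_gen (g : bs_gen) := if g is gen_a then false else true.
Definition bs_gen_of_bool (b : bool) := if b then gen_b else gen_a.
Lemma bool_of_bs_genK : cancel bool_of_bs_gen bs_gen_of_bool.
Proof. by case. Qed.
HB.instance Definition _ := Countable.copy bs_gen (can_type bool_of_bs_genK).

Definition bs_rel (k : nat) (u v : gword bs_gen) : Prop :=
  u = [:: (gen_b, true); (gen_a, false); (gen_b, false)] /\
  v = nseq k (gen_a, false).

Definition BS (k : nat) : groupType := presented (bs_rel k).

Definition bs_elt (k : nat) (g : bs_gen) : BS k :=
  pres_class (bs_rel k) [:: (g, false)].

Lemma bs_relE (k : nat) :
  ((bs_elt k gen_b)^-1 * (bs_elt k gen_a * bs_elt k gen_b)
   = bs_elt k gen_a ^+ k)%g.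
Proof.
have powE n : (bs_elt k gen_a ^+ n)%g
            = pres_class (bs_rel k) (nseq n (gen_a, false)).
  by elim: n => [//|n IHn]; rewrite expgS IHn [(_ * _)%g]pres_classM.
rewrite powE.
rewrite [(_^-1)%g]pres_classV [(bs_elt k gen_a * _)%g]pres_classM.
by rewrite [(_ * _)%g]pres_classM; apply/pres_classP; exact: pres_rel.
Qed.

(* An equation w(x_0, ..., x_(n-1), a, b) = 1; the list of the variables is   *)
(* part of the data, and a variable need not occur in w.                      *)
Record equation := Equation {
  eq_nvars : nat;
  eq_word : gword ('I_eq_nvars + bs_gen) }.

Definition occurrences (T : eqType) (x : T) (w : gword T) : nat :=
  count (fun l => l.1 == x) w.

Definition quadratic (E : equation) : Prop :=
  forall x : 'I_(eq_nvars E),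
    0 < occurrences (inl x) (eq_word E) -> occurrences (inl x) (eq_word E) = 2.

Definition is_solution (k : nat) (E : equation) (s : 'I_(eq_nvars E) -> BS k) :
    Prop :=
  weval (fun t => match t with inl x => s x | inr g => bs_elt k g end)
        (eq_word E) = 1%g.

Definition solvable_in_BS (k : nat) (E : equation) : Prop :=
  exists s : 'I_(eq_nvars E) -> BS k, is_solution s.

(* A finite system of coefficient-free equations w(x_0, ..., x_(n-1)) = 1.    *)
Record cf_system := CfSystem {
  sys_nvars : nat;
  sys_words : seq (gword 'I_sys_nvars) }.

Definition is_sys_solution (G : groupType) (S : cf_system)
    (s : 'I_(sys_nvars S) -> G) : Prop :=
  forall w, w \in sys_words S -> weval s w = 1%g.

Definition nontrivially_solvable_in_BS (k : nat) (S : cf_system) : Prop :=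
  exists s : 'I_(sys_nvars S) -> BS k,
    is_sys_solution s /\ exists x, s x <> 1%g.

(* Goedel numbers                                                             *)
Definition word_code (T : Type) (idx : T -> nat) (w : gword T) : nat :=
  CodeSeq.code [seq (idx l.1).*2 + l.2 | l : T * bool <- w].

Definition letter_index (n : nat) (t : 'I_n + bs_gen) : nat :=
  match t with inr gen_a => 0 | inr gen_b => 1 | inl x => x.+2 end.

Definition equation_code (E : equation) : nat :=
  CodeSeq.code [:: eq_nvars E; word_code (@letter_index _) (eq_word E)].

Definition system_code (S : cf_system) : nat :=
  CodeSeq.code (sys_nvars S ::
    [seq word_code (@nat_of_ord (sys_nvars S)) w | w <- sys_words S]).

Lemma word_code_inj T (idx : T -> nat) :
  injective idx -> injective (word_code idx).
Proof.
move=> idxI u v /(can_inj CodeSeq.codeK); apply: inj_map => -[x b] [y c] /= e.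
have ebc : b = c by move/(congr1 odd): e; rewrite !oddD !odd_double !oddb.
by move: e; rewrite ebc => /addIn/double_inj/idxI ->.
Qed.

Lemma letter_index_inj n : injective (@letter_index n).
Proof. by move=> [x|[]] [y|[]] //= [] /val_inj ->. Qed.

Lemma equation_code_inj : injective equation_code.
Proof.
move=> [m u] [n v] /(can_inj CodeSeq.codeK)[/= emn]; case: n / emn v => v.
by move/(word_code_inj (@letter_index_inj m)) ->.
Qed.

Lemma system_code_inj : injective system_code.
Proof.
move=> [m u] [n v] /(can_inj CodeSeq.codeK)[/= emn]; case: n / emn v => v.
by move/(inj_map (word_code_inj (@ord_inj m))) ->.
Qed.

(* Main.v *)
(* BS(1,k) is the group of pairs (n, u), n in Z, u in Z[1/k], standing for the
   maps x |-> k^(-n) x + u.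

   Quadratic equations. Given the exponents n of the variables, the equation is
   linear in their translation parts u; a variable occurring at positions i < j
   has the coefficient k^e (k^d - 1) or k^e (k^d + 1), d being the difference of
   the exponents of b read at i and j. On the exponents balancing the equation,
   2d is a linear form whose coefficients at the variables are 0 or +-2. So d is
   either bounded by the length of the word, or takes any prescribed value, and
   then choosing d = 1 or d = 0 makes the coefficient k - 1 or 2, up to a unit.
   In all cases a solution modulo a suitable N = k^g - 1 lifts, except when all
   the coefficients vanish modulo N; then the residues modulo g of the exponents
   of b along the word leave a large gap on the circle Z/g, and cutting there
   gives integral exponents for which the equation is an equality of integers
   smaller than N. Hence solvability is equivalent to solvability in a finite
   quotient of computable size, which is tested by exhaustion.

   Coefficient-free systems. Projecting to Z, or else to the torsion-free group
   Z[1/k], a non-trivial solution yields a non-zero rational solution of the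
   abelianized system, and conversely. This is also tested modulo a suitable
   number. *)

Require Import Defs.
From mathcomp Require Import all_boot.
From mathcomp Require Import all_order all_algebra.
From mathcomp Require Import boolp.
From mathcomp Require Import zify ring.

Set Implicit Arguments.
Unset Strict Implicit.
Unset Printing Implicit Defensive.

Import Order.TTheory GRing.Theory Num.Theory.

(** * Closure properties of recursive functions *)

(* Variables are the entries of a list, so that binding a variable is consing. *)
Definition crec n (F : seq nat -> nat) : Prop :=
  recursive (fun v : n.-tuple nat => F v).

Lemma crec_ext n F G : (forall v, size v = n -> F v = G v) ->
  crec n G -> crec n F.
Proof.
move=> FG; rewrite /crec; congr recursive; apply/funext => v.
by rewrite FG ?size_tuple.
Qed.

Lemma crec_var n i : i < n -> crec n (fun v => nth 0 v i).
Proof. by move=> lt_in; apply: (@recursive_proj _ (Ordinal lt_in)) => v;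
  rewrite (tnth_nth 0). Qed.

Lemma crec_comp m n H G : crec m H -> (forall i, i < m -> crec n (G i)) ->
  crec n (fun v => H (mkseq (fun i => G i v) m)).
Proof.
move=> recH recG.
apply: (recursive_comp recH (g := fun i v => G i v)) => [i|v]; first exact: recG.
by rewrite /= /mkseq -val_enum_ord -map_comp.
Qed.

Lemma crec_const n a : crec n (fun=> a).
Proof.
elim: a => [|a IHa]; first exact: recursive_zero.
have recS : crec 1 (fun v => (nth 0 v 0).+1).
  by apply: recursive_succ => x.
by apply: (crec_comp (G := fun _ _ => a) recS).
Qed.

(** The recursion runs over an extra leading argument, for which [T v] is substituted afterwards. In
    the step function, entry 0 is the counter and entry 1 the previous value. *)
Lemma crec_rec n T G H : crec n T -> crec n G -> crec n.+2 H ->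
  crec n (fun v => iteri (T v) (fun x r => H (x :: r :: v)) (G v)).
Proof.
move=> recT recG recH.
pose F v := iteri (head 0 v) (fun x r => H (x :: r :: behead v)) (G (behead v)).
have recF : crec n.+1 F by apply: (recursive_primrec recG recH) => [v|x v].
apply: crec_ext (crec_comp (G := fun i v => nth 0 (T v :: v) i) recF _) => [v sv|].
  rewrite -[LHS]/(F (T v :: v)); congr F.
  by rewrite -{1}[T v :: v](mkseq_nth 0) /= sv.
by case=> [|i] lt_in //; apply: crec_var.
Qed.

Section Arithmetic.
Variable n : nat.
Implicit Types F G : seq nat -> nat.

Lemma crec_comp1 (f : nat -> nat) F :
  crec 1 (fun v => f (nth 0 v 0)) -> crec n F -> crec n (fun v => f (F v)).
Proof. by move=> recf recF; apply: (crec_comp (G := fun _ => F) recf). Qed.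

Lemma crec_comp2 (f : nat -> nat -> nat) F G :
  crec 2 (fun v => f (nth 0 v 0) (nth 0 v 1)) -> crec n F -> crec n G ->
  crec n (fun v => f (F v) (G v)).
Proof.
move=> recf recF recG.
apply: (crec_comp (G := fun i v => if i == 0 then F v else G v) recf).
by move=> [|i] _.
Qed.

Lemma crec_S F : crec n F -> crec n (fun v => (F v).+1).
Proof. by apply: crec_comp1; apply: recursive_succ => x. Qed.
End Arithmetic.

Lemma crec_add n F G : crec n F -> crec n G -> crec n (fun v => F v + G v).
Proof.
apply: crec_comp2; apply: (@crec_ext _ _
  (fun v => iteri (nth 0 v 1) (fun x r => (nth 0 (x :: r :: v) 1).+1) (nth 0 v 0))).
  by move=> v _; elim: (nth 0 v 1) => [|m /= <-]; rewrite ?addn0 ?addnS.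
by apply: (crec_rec (H := fun v => (nth 0 v 1).+1)); do ?apply: crec_S;
  apply: crec_var.
Qed.

(** Bounded sums count, so division, bounded quantifiers and 2-adic valuations are all reduced to
    them below. *)
Lemma crec_sum n B F : crec n B -> crec n.+1 F ->
  crec n (fun v => \sum_(i < B v) F (nat_of_ord i :: v)).
Proof.
move=> recB recF.
apply: (@crec_ext _ _
  (fun v => iteri (B v) (fun x r => (fun u =>
    nth 0 u 1 + F (nth 0 u 0 :: drop 2 u)) (x :: r :: v)) 0)).
  move=> v _; elim: (B v) => [|m IHm]; first by rewrite big_ord0.
  by rewrite big_ord_recr IHm /= drop0.
apply: (@crec_rec _ _ (fun=> 0)
  (fun u => nth 0 u 1 + F (nth 0 u 0 :: drop 2 u))) => //; first exact: crec_const.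
apply: crec_add; first exact: crec_var.
apply: crec_ext (crec_comp
  (G := fun i v => nth 0 v (if i == 0 then 0 else i.+1)) recF _) => [v sv|].
  congr F; apply: (@eq_from_nth _ 0);
    rewrite /= size_drop sv ?size_map ?size_iota ?subSS ?subn0 //.
  by move=> [|i] lt_i; rewrite nth_mkseq //= nth_drop.
by move=> [|i] lt_i; apply: crec_var.
Qed.

Lemma crec_mul n F G : crec n F -> crec n G -> crec n (fun v => F v * G v).
Proof.
apply: crec_comp2; apply: (@crec_ext _ _ (fun v =>
  \sum_(i < nth 0 v 1) nth 0 (nat_of_ord i :: v) 1)).
  by move=> v _; rewrite sum_nat_const card_ord mulnC.
by apply: (@crec_sum 2 _ (fun u => nth 0 u 1)); apply: crec_var.
Qed.

Lemma crec_exp n F G : crec n F -> crec n G -> crec n (fun v => F v ^ G v).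
Proof.
apply: crec_comp2; apply: (@crec_ext _ _
  (fun v => iteri (nth 0 v 1) (fun x r => (fun u =>
    nth 0 u 1 * nth 0 u 2) (x :: r :: v)) 1)).
  by move=> v _; elim: (nth 0 v 1) => [|m /= <-]; rewrite ?expn0 ?expnSr.
apply: (@crec_rec 2 _ (fun=> 1) (fun u => nth 0 u 1 * nth 0 u 2)).
- exact: crec_var.
- exact: crec_const.
- by apply: crec_mul; apply: crec_var.
Qed.

Lemma crec_fact n F : crec n F -> crec n (fun v => (F v)`!).
Proof.
apply: crec_comp1; apply: (@crec_ext _ _
  (fun v => iteri (nth 0 v 0) (fun x r => (fun u =>
    (nth 0 u 0).+1 * nth 0 u 1) (x :: r :: v)) 1)).
  by move=> v _; elim: (nth 0 v 0) => [|m /= <-]; rewrite ?fact0 ?factS.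
apply: (@crec_rec 1 _ (fun=> 1) (fun u => (nth 0 u 0).+1 * nth 0 u 1)).
- exact: crec_var.
- exact: crec_const.
- by apply: crec_mul; do ?apply: crec_S; apply: crec_var.
Qed.

Lemma crec_pred n F : crec n F -> crec n (fun v => (F v).-1).
Proof.
apply: crec_comp1; apply: (@crec_ext _ _
  (fun v => iteri (nth 0 v 0) (fun x r => (fun u => nth 0 u 0) (x :: r :: v)) 0)).
  by move=> v _; case: (nth 0 v 0).
by apply: (@crec_rec 1 _ (fun=> 0) (fun u => nth 0 u 0));
  (exact: crec_var || exact: crec_const).
Qed.

Lemma crec_sub n F G : crec n F -> crec n G -> crec n (fun v => F v - G v).
Proof.
apply: crec_comp2; apply: (@crec_ext _ _
  (fun v => iteri (nth 0 v 1) (fun x r => (fun u =>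
    (nth 0 u 1).-1) (x :: r :: v)) (nth 0 v 0))).
  by move=> v _; elim: (nth 0 v 1) => [|m /= <-]; rewrite ?subn0 ?subnS.
by apply: (@crec_rec 2 _ _ (fun u => (nth 0 u 1).-1)); do ?apply: crec_pred;
  apply: crec_var.
Qed.

Lemma crec_eq0 n F : crec n F -> crec n (fun v => F v == 0).
Proof.
move=> recF; apply: (@crec_ext _ _ (fun v => 1 - F v)) => [v _|].
  by case: (F v).
by apply: crec_sub => //; apply: crec_const.
Qed.

Lemma crec_not n (P : seq nat -> bool) : crec n P -> crec n (fun v => ~~ P v).
Proof.
move=> recP; apply: (@crec_ext _ _ (fun v => P v == 0 :> nat)) => [v _|].
  by case: (P v).
exact: crec_eq0.
Qed.

Lemma crec_and n (P Q : seq nat -> bool) :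
  crec n P -> crec n Q -> crec n (fun v => P v && Q v).
Proof.
move=> recP recQ; apply: (@crec_ext _ _ (fun v => P v * Q v)) => [v _|].
  by rewrite mulnb.
exact: crec_mul.
Qed.

Lemma crec_leq n F G : crec n F -> crec n G -> crec n (fun v => F v <= G v).
Proof. by move=> recF recG; apply: crec_eq0; apply: crec_sub. Qed.

Lemma crec_eq n F G : crec n F -> crec n G -> crec n (fun v => F v == G v).
Proof.
move=> recF recG; apply: (@crec_ext _ _ (fun v => (F v <= G v) && (G v <= F v))).
  by move=> v _; rewrite eqn_leq.
by apply: crec_and; apply: crec_leq.
Qed.

(** The quotient counts the positive multiples of [d] up to [m]; the test [0 < d] matches the
    convention [m %/ 0 = 0]. *)
Lemma divn_sum m d : m %/ d = \sum_(i < m) ((0 < d) && (i.+1 * d <= m)).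
Proof.
have [->|d_gt0] := posnP d; first by rewrite divn0 big1.
transitivity (\sum_(i < m) (i < m %/ d)).
  rewrite -(big_mkord xpredT (fun i => (i < m %/ d : nat))).
  rewrite (big_cat_nat (n := m %/ d)) ?leq_div //=.
  rewrite [X in _ = _ + X]big_nat_cond [X in _ = _ + X]big1 ?addn0.
    rewrite (eq_big_nat _ _ (F2 := fun=> 1)) => [|i /andP[_ ->//]].
    by rewrite sum_nat_const_nat muln1 subn0.
  by move=> i; rewrite andbT leqNgt => /andP[/negbTE->].
by apply: eq_bigr => i _; rewrite leq_divRL.
Qed.

Lemma crec_div n F G : crec n F -> crec n G -> crec n (fun v => F v %/ G v).
Proof.
apply: crec_comp2; apply: (@crec_ext _ _ (fun v => \sum_(i < nth 0 v 0)
  (fun u => (1 <= nth 0 u 2) && ((nth 0 u 0).+1 * nth 0 u 2 <= nth 0 u 1) : nat)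
    (nat_of_ord i :: v))).
  by move=> v _; rewrite divn_sum.
apply: (@crec_sum 2 _ (fun u =>
  (1 <= nth 0 u 2) && ((nth 0 u 0).+1 * nth 0 u 2 <= nth 0 u 1)));
    first exact: crec_var.
by apply: crec_and; apply: crec_leq; do ?[apply: crec_mul|apply: crec_S];
  (exact: crec_const || apply: crec_var).
Qed.

Lemma crec_mod n F G : crec n F -> crec n G -> crec n (fun v => F v %% G v).
Proof.
move=> recF recG; apply: (@crec_ext _ _ (fun v => F v - F v %/ G v * G v)).
  by move=> v _; rewrite {2}(divn_eq (F v) (G v)) addKn.
by apply: crec_sub => //; apply: crec_mul => //; apply: crec_div.
Qed.

Lemma crec_dvd n F G : crec n F -> crec n G -> crec n (fun v => F v %| G v).
Proof. by move=> recF recG; apply: crec_eq0; apply: crec_mod. Qed.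

Lemma crec_ex n B (P : seq nat -> bool) : crec n B -> crec n.+1 P ->
  crec n (fun v => [exists i : 'I_(B v), P (nat_of_ord i :: v)]).
Proof.
move=> recB recP.
apply: (@crec_ext _ _ (fun v => ~~ (\sum_(i < B v) P (nat_of_ord i :: v) == 0))).
  move=> v _; congr nat_of_bool; rewrite sum_nat_eq0 negb_forall /=.
  by apply: eq_existsb => i; rewrite eqb0 negbK.
by apply: crec_not; apply: crec_eq0; apply: (@crec_sum _ _ (fun u => P u)).
Qed.

Lemma crec_half n F : crec n F -> crec n (fun v => (F v)./2).
Proof.
move=> recF; apply: (@crec_ext _ _ (fun v => F v %/ 2)) => [v _|].
  by rewrite divn2.
by apply: crec_div => //; apply: crec_const.
Qed.

Lemma crec_odd n F : crec n F -> crec n (fun v => odd (F v)).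
Proof.
move=> recF; apply: (@crec_ext _ _ (fun v => F v %% 2)) => [v _|].
  by rewrite modn2.
by apply: crec_mod => //; apply: crec_const.
Qed.

Lemma crec_head n : crec n.+1 (fun u => head 0 u).
Proof. by apply: (@crec_ext _ _ (fun u => nth 0 u 0)) => //; apply: crec_var. Qed.

Lemma crec_weak n F : crec n F -> crec n.+1 (fun u => F (behead u)).
Proof.
move=> recF; apply: crec_ext (crec_comp (G := fun i v => nth 0 v i.+1) recF _).
  move=> v sv; congr F; apply: (@eq_from_nth _ 0).
    by rewrite size_behead size_mkseq sv.
  by move=> i; rewrite size_behead sv => lt_i; rewrite nth_behead nth_mkseq.
by move=> i lt_i; apply: crec_var.
Qed.

Lemma crec_weak2 n F : crec n F -> crec n.+2 (fun u => F (behead (behead u))).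
Proof. by move=> recF; apply: (@crec_weak _ (fun u => F (behead u)));
  apply: crec_weak. Qed.

(** Here and in the next two lemmas the bound variable is a separate argument of the body, which is
    the shape in which the decision procedures are written. *)
Lemma crec_sumb n B (F : nat -> seq nat -> nat) : crec n B ->
  crec n.+1 (fun u => F (head 0 u) (behead u)) ->
  crec n (fun v => \sum_(0 <= i < B v) F i v).
Proof.
move=> recB /(crec_sum recB); apply: crec_ext => v _ /=.
by rewrite big_mkord.
Qed.

Lemma crec_has n B (P : nat -> seq nat -> bool) : crec n B ->
  crec n.+1 (fun u => P (head 0 u) (behead u)) ->
  crec n (fun v => has (P^~ v) (iota 0 (B v))).
Proof.
move=> recB /(crec_ex (P := fun u => P (head 0 u) (behead u)) recB).
apply: crec_ext => v _; congr nat_of_bool; apply/hasP/existsP => [[i]|[i Pi]].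
  by rewrite mem_iota => /= lt_i Pi; exists (Ordinal lt_i).
by exists (val i); rewrite // mem_iota /=.
Qed.

Lemma crec_allb n B (P : nat -> seq nat -> bool) : crec n B ->
  crec n.+1 (fun u => P (head 0 u) (behead u)) ->
  crec n (fun v => all (P^~ v) (iota 0 (B v))).
Proof.
move=> recB recP; apply: (@crec_ext _ _ (fun v => ~~ has (fun i =>
  ~~ P i v) (iota 0 (B v)))).
  by move=> v _; rewrite has_predC negbK.
by apply: crec_not; apply: crec_has => //; apply: crec_not.
Qed.

(** * Decoding Goedel numbers *)

(* CodeSeq.code (x :: s) = 2 ^ x * (2 * code s + 1) *)
Definition code_behead (c : nat) : nat := (c %/ 2 ^ logn 2 c)./2.
Definition code_nth (c t : nat) : nat := logn 2 (iter t code_behead c).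
(** The empty list has code 0 and a code is at least the length of its list, so the nonzero iterated
    tails with index below [c] are as many as the entries. *)
Definition code_size (c : nat) : nat := \sum_(0 <= t < c) (iter t code_behead c
  != 0).

Ltac crec :=
  repeat first
  [ exact: crec_const | exact: crec_head | assumption
  | by apply: crec_weak | by apply: crec_weak2 | by apply: crec_var
  | apply: crec_add | apply: crec_sub | apply: crec_mul | apply: crec_exp |
    apply: crec_mod
  | apply: crec_div | apply: crec_half | apply: crec_fact | apply: crec_pred
  | apply: crec_odd | apply: crec_leq | apply: crec_eq | apply: crec_dvd
  | apply: crec_not | apply: crec_and
  | apply: crec_sumb | apply: crec_has | apply: crec_allb | apply: crec_S ].

Lemma crec_logn2 n F : crec n F -> crec n (fun v => logn 2 (F v)).
Proof.
move=> recF.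
apply: (@crec_ext _ _ (fun v => \sum_(0 <= i < F v) ((0 < i) && (2 ^ i %| F v)))).
  move=> v _; have [->|Fv_gt0] := posnP (F v); first by rewrite big_geq.
  rewrite logn_count_dvd // [RHS]big_ltn // add0n.
  by apply: eq_big_nat => i /andP[->].
crec.
Qed.

Lemma crec_code_behead n F : crec n F -> crec n (fun v => code_behead (F v)).
Proof. by move=> recF; rewrite /code_behead; crec; apply: crec_logn2. Qed.

Lemma crec_iter_behead n F T : crec n F -> crec n T ->
  crec n (fun v => iter (T v) code_behead (F v)).
Proof.
move=> recF recT.
apply: (@crec_ext _ _ (fun v => iteri (T v)
  (fun x r => (fun u => code_behead (nth 0 u 1)) (x :: r :: v)) (F v))).
  by move=> v _; elim: (T v) => //= m ->.
by apply: (@crec_rec _ _ _ (fun u => code_behead (nth 0 u 1))); rewrite //;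
  apply: crec_code_behead; apply: crec_var.
Qed.

Lemma crec_code_nth n F T : crec n F -> crec n T ->
  crec n (fun v => code_nth (F v) (T v)).
Proof. by move=> recF recT; apply: crec_logn2; apply: crec_iter_behead. Qed.

Lemma crec_code_size n F : crec n F -> crec n (fun v => code_size (F v)).
Proof.
move=> recF; rewrite /code_size; crec.
by apply: (@crec_iter_behead n.+1); crec.
Qed.

Lemma code_cons x s : CodeSeq.code (x :: s) = 2 ^ x * (CodeSeq.code s).*2.+1.
Proof. by []. Qed.

Lemma logn2_code_cons x s : logn 2 (CodeSeq.code (x :: s)) = x.
Proof.
rewrite code_cons lognM ?expn_gt0 // pfactorK // logn_coprime ?addn0 //.
by rewrite coprime2n /= odd_double.
Qed.

Lemma code_behead_cons x s : code_behead (CodeSeq.code (x :: s)) = CodeSeq.code s.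
Proof.
by rewrite /code_behead logn2_code_cons code_cons mulKn ?expn_gt0 //= uphalf_double.
Qed.

Lemma iter_code_behead s t : iter t code_behead (CodeSeq.code s) = CodeSeq.code
  (drop t s).
Proof.
elim: t s => [|t IHt] s; first by rewrite drop0.
rewrite iterSr; case: s => [|x s]; last by rewrite code_behead_cons IHt.
have -> : code_behead (CodeSeq.code [::]) = CodeSeq.code [::] by [].
by rewrite IHt !drop_oversize.
Qed.

Lemma code_nthE s t : code_nth (CodeSeq.code s) t = nth 0 s t.
Proof.
rewrite /code_nth iter_code_behead -{2}[t]addn0 -nth_drop.
by case: (drop t s) => [//|x r]; rewrite logn2_code_cons.
Qed.

Lemma code_gt_size s : size s <= CodeSeq.code s.
Proof.
elim: s => //= x s IHs; have: 0 < 2 ^ x by rewrite expn_gt0.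
by move: IHs; rewrite -!/(CodeSeq.code _); nia.
Qed.

Lemma code_gt_nth s t : nth 0 s t <= CodeSeq.code s.
Proof.
elim: s t => [|x s IHs] [|t] //=; rewrite -!/(CodeSeq.code _).
  by have := ltn_expl x (isT : 1 < 2); nia.
by apply: leq_trans (IHs t) _; have: 0 < 2 ^ x by [rewrite expn_gt0]; nia.
Qed.

Lemma code_eq0 s : (CodeSeq.code s == 0) = (s == [::]).
Proof. by case: s => [//|x s]; rewrite code_cons muln_eq0 expn_eq0. Qed.

Lemma code_sizeE s : code_size (CodeSeq.code s) = size s.
Proof.
rewrite /code_size (big_cat_nat (n := size s)) ?code_gt_size //=.
rewrite [X in _ + X]big_nat_cond [X in _ + X]big1 ?addn0.
  rewrite (eq_big_nat _ _ (F2 := fun=> 1)) => [|t /andP[_ lt_t]].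
    by rewrite sum_nat_const_nat muln1 subn0.
  by rewrite iter_code_behead code_eq0 -size_eq0 size_drop subn_eq0 -ltnNge lt_t.
by move=> t /andP[/andP[le_t _] _]; rewrite iter_code_behead drop_oversize.
Qed.

(** An assignment of values below [B] to finitely many letters is stored as the base-[B] digits of
    one number, so that running through all assignments is a bounded search. *)
Definition digit (B y i : nat) : nat := y %/ B ^ i %% B.

Lemma crec_digit n B Y I : crec n B -> crec n Y -> crec n I ->
  crec n (fun v => digit (B v) (Y v) (I v)).
Proof. by rewrite /digit => *; crec. Qed.

Lemma digit_ex B m (f : nat -> nat) : (forall i, i < m -> f i < B) ->
  exists2 y, y < B ^ m & forall i, i < m -> digit B y i = f i.
Proof.
elim: m f => [|m IHm] f lt_f; first by exists 0.
have [y lt_y yP] := IHm (f \o succn) (fun i => lt_f i.+1).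
have B_gt0 : 0 < B by apply: leq_ltn_trans (lt_f 0 _).
have lt_f0 : f 0 < B by apply: lt_f.
exists (y * B + f 0); first by rewrite expnSr; nia.
case=> [|i] lt_i; rewrite /digit.
  by rewrite divn1 modnMDl modn_small.
by rewrite expnS divnMA divnMDl // (divn_small lt_f0) addn0; apply: yP.
Qed.

Lemma digit_lt B y i : 0 < B -> digit B y i < B.
Proof. exact: ltn_pmod. Qed.

Local Open Scope ring_scope.

(** * Divisibility in Z[1/k] *)

Section Kfrac.
Variable k : nat.
Hypothesis k_gt0 : (0 < k)%N.
Implicit Types (u v d : rat) (m n : int).

Notation kq := (k%:R : rat).

Definition kfrac u : Prop := exists (z : int) (p : nat), u = z%:~R / kq ^+ p.

(** Divisibility of [u] by [d] in Z[1/k], as membership in the principal ideal generated by [d]. *)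
Definition kideal d u : Prop := exists2 v, kfrac v & u = d * v.

Lemma kq_neq0 : kq != 0. Proof. by rewrite pnatr_eq0 -lt0n. Qed.
Lemma kqX_neq0 p : kq ^+ p != 0. Proof. by rewrite expf_neq0 ?kq_neq0. Qed.

Lemma kfrac_int (z : int) : kfrac z%:~R.
Proof. by exists z, 0%N; rewrite expr0 divr1. Qed.

Lemma kfrac_nat (n : nat) : kfrac n%:R.
Proof. by rewrite -[n%:R]/(n%:Z%:~R); apply: kfrac_int. Qed.

Lemma kfrac0 : kfrac 0. Proof. exact: (kfrac_int 0). Qed.
Lemma kfrac1 : kfrac 1. Proof. exact: (kfrac_int 1). Qed.

Lemma kfracD u v : kfrac u -> kfrac v -> kfrac (u + v).
Proof.
move=> [x [p ->]] [y [q ->]]; exists (x * k%:Z ^+ q + y * k%:Z ^+ p), (p + q)%N.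
rewrite intrD !intrM !rmorphXn /= exprD.
by have := kqX_neq0 p; have := kqX_neq0 q; rewrite -!(pmulrn _ k) => *; field;
  apply/andP.
Qed.

Lemma kfracM u v : kfrac u -> kfrac v -> kfrac (u * v).
Proof.
move=> [x [p ->]] [y [q ->]]; exists (x * y), (p + q)%N.
by rewrite intrM exprD invfM mulrACA.
Qed.

Lemma kfracN u : kfrac u -> kfrac (- u).
Proof. by move=> [x [p ->]]; exists (- x), p; rewrite intrN mulNr. Qed.

Lemma kfracB u v : kfrac u -> kfrac v -> kfrac (u - v).
Proof. by move=> uP vP; apply: kfracD => //; apply: kfracN. Qed.

Lemma kfrac_exp m : kfrac (kq ^ m).
Proof.
case: m => p; first by exists (k%:Z ^+ p), 0%N; rewrite expr0 divr1 rmorphXn.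
by exists 1, p.+1; rewrite NegzE -exprnN mul1r.
Qed.

Lemma kideal0 d : kideal d 0.
Proof. by exists 0; rewrite ?mulr0 //; apply: kfrac0. Qed.

Lemma kidealD d u v : kideal d u -> kideal d v -> kideal d (u + v).
Proof. by move=> [x xP ->] [y yP ->]; exists (x + y); [apply: kfracD | ring]. Qed.

Lemma kidealMr d u v : kideal d u -> kfrac v -> kideal d (u * v).
Proof. by move=> [x xP ->] vP; exists (x * v); [apply: kfracM | ring]. Qed.

Lemma kidealMl d u v : kfrac v -> kideal d u -> kideal d (v * u).
Proof. by move=> *; rewrite mulrC; apply: kidealMr. Qed.

Lemma kidealN d u : kideal d u -> kideal d (- u).
Proof. by move=> [x xP ->]; exists (- x); [apply: kfracN | ring]. Qed.

Lemma kideal_id d : kideal d d.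
Proof. by exists 1; [apply: kfrac1 | rewrite mulr1]. Qed.

Lemma kideal_trans d e u : kideal e d -> kideal d u -> kideal e u.
Proof. by move=> de [v vP ->]; apply: kidealMr. Qed.

Lemma kideal_sum d (I : Type) (r : seq I) (P : pred I) (F : I -> rat) :
  (forall i, P i -> kideal d (F i)) -> kideal d (\sum_(i <- r | P i) F i).
Proof. by move=> FP; elim/big_ind: _ => //; [apply: kideal0 | apply: kidealD]. Qed.

Lemma kideal_congr d u v : kideal d (u - v) -> kideal d v -> kideal d u.
Proof. by move=> uv vP; rewrite -(subrK v u); apply: kidealD. Qed.

Lemma kideal_subX_nat u (n : nat) : kfrac u -> kideal (u - 1) (u ^+ n - 1).
Proof.
move=> uP; elim: n => [|n IHn]; first by rewrite expr0 subrr; apply: kideal0.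
have -> : u ^+ n.+1 - 1 = u * (u ^+ n - 1) + (u - 1) by rewrite exprS; ring.
by apply: kidealD; [apply: kidealMl | apply: kideal_id].
Qed.

Lemma kexpD m n : kq ^ (m + n) = kq ^ m * kq ^ n.
Proof. by rewrite expfzDr ?kq_neq0. Qed.

Lemma kexp_neq0 m : kq ^ m != 0.
Proof. by rewrite expfz_neq0 ?kq_neq0. Qed.

Lemma kideal_subX m n : (m %| n)%Z -> kideal (kq ^ m - 1) (kq ^ n - 1).
Proof.
(* For negative q, k^(qm) - 1 is k^(-qm) - 1 times the unit -k^(qm). *)
case/dvdzP => q ->; wlog q_ge0 : q / 0 <= q => [H|].
  have [/H//|q_lt0] := leP 0 q.
  have -> : kq ^ (q * m) - 1 = - (kq ^ (q * m)) * (kq ^ (- q * m) - 1).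
    by rewrite mulrBr mulr1 mulNr -kexpD mulNr subrr expr0z; ring.
  by apply: kidealMl; [apply/kfracN/kfrac_exp | apply: H; lia].
case: q q_ge0 => // q _; rewrite mulrC -exprz_exp -exprnP.
by apply: kideal_subX_nat; apply: kfrac_exp.
Qed.

Lemma kideal_subX_congr m n1 n2 : (m %| n1 - n2)%Z ->
  kideal (kq ^ m - 1) (kq ^ n1 - kq ^ n2).
Proof.
move=> dvd_m; have -> : kq ^ n1 - kq ^ n2 = kq ^ n2 * (kq ^ (n1 - n2) - 1).
  by rewrite mulrBr -kexpD mulr1 [n2 + _]addrC subrK.
by apply: kidealMl; [apply: kfrac_exp | apply: kideal_subX].
Qed.

(** If k is odd then k - 1 is even; if k is even then 2 divides k and is a unit of Z[1/k]. *)
Lemma kideal2_pred : kideal 2 (kq - 1).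
Proof.
have [k_odd|k_even] := boolP (odd k).
  exists (k./2)%:R; first exact: kfrac_nat.
  have -> : kq = 1 + 2 * (k./2)%:R by rewrite -[k in LHS]odd_double_half k_odd
    -mul2n natrD natrM.
  by ring.
exists ((kq - 1) * ((k./2)%:R * kq ^ (-1))).
  apply: kfracM; first by apply: kfracB; [apply: kfrac_nat | apply: kfrac1].
  by apply: kfracM; [apply: kfrac_nat | apply: kfrac_exp].
have kE : kq = 2 * (k./2)%:R by rewrite -[k in LHS]odd_double_half (negbTE
  k_even) -mul2n natrM.
have kV : kq ^ (-1) = kq^-1 by [].
have := kq_neq0; rewrite kV kE mulf_eq0 negb_or => /andP[_ half_neq0].
by field.
Qed.

(** Clearing the denominator leaves N | z k^p in Z, and k is invertible modulo N. *)
Lemma kideal_natP (N : nat) (z : int) : coprime N k ->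
  kideal N%:R (z%:~R) -> (N%:Z %| z)%Z.
Proof.
move=> copNk [_ [y [p ->]] zE].
have {}zE : z * k%:Z ^+ p = N%:Z * y.
  apply: (@intr_inj rat); rewrite !intrM rmorphXn zE -!pmulrn.
  by rewrite mulrA divfK ?kqX_neq0.
have: (N%:Z %| z * k%:Z ^+ p)%Z by rewrite zE dvdz_mulr.
by rewrite Gauss_dvdzl // coprimezXr.
Qed.

End Kfrac.

(** * Exponents along a quadratic word *)

(* A word of length L has the letter X p at position p, inverted if s p; the
   letters 0 and 1 are a and b, the others are variables. Under the assignment
   of (nu z, mu z) to the letter z, the word takes the value
   (walk nu L, apart nu mu). *)
Section Positions.
Variables (k L : nat) (X : nat -> nat) (s : nat -> bool).
Hypothesis k_gt0 : (0 < k)%N.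

Notation kq := (k%:R : rat).
Implicit Types (nu : nat -> int) (mu : nat -> rat).

Definition sgp (p : nat) : int := if s p then -1 else 1.
Definition walk nu p : int := \sum_(l < p) sgp l * nu (X l).
(** A letter (n, u) read after the exponent e contributes k^(-e) u to the translation part. Its
    inverse (-n, -k^n u) contributes -k^(-(e - n)) u, and e - n is the exponent after that letter;
    hence the shift by [s p]. *)
Definition pos nu p : int := walk nu (p + s p).
Definition apart nu mu : rat := \sum_(p < L) (sgp p)%:~R * kq ^ (- pos nu p) *
  mu (X p).
Definition coef nu z : rat := \sum_(p < L | X p == z) (sgp p)%:~R * kq ^ (- pos
  nu p).
Definition scount z : int := \sum_(p < L | X p == z) sgp p.

Definition normalized nu mu : Prop :=
  [/\ nu 0%N = 0, nu 1%N = 1, mu 0%N = 1, mu 1%N = 0 & forall z, kfrac k (mu z)].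

Definition paired i j := [/\ (i < j < L)%N, X i = X j &
  forall p, (p < L)%N -> X p = X i -> p = i \/ p = j].

Definition quadr := forall p, (p < L)%N -> (1 < X p)%N ->
  exists i j, paired i j /\ X i = X p.

Lemma sgp_cases p : sgp p = 1 \/ sgp p = -1.
Proof. by rewrite /sgp; case: s; [right | left]. Qed.

Lemma regroup (R : comPzRingType) (F f : nat -> R) Z :
  (forall p, (p < L)%N -> (X p < Z)%N) ->
  \sum_(p < L) F p * f (X p) = \sum_(z < Z) (\sum_(p < L | X p == z) F p) * f z.
Proof.
move=> X_lt; under [RHS]eq_bigr => z _ do rewrite mulr_suml big_mkcond.
rewrite exchange_big; apply: eq_bigr => p _ /=.
rewrite (bigD1 (Ordinal (X_lt p (ltn_ord p)))) //= eqxx big1 ?addr0 // => z z_neq.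
by rewrite ifN // eq_sym; apply: contraNneq z_neq => zE; apply/eqP/val_inj.
Qed.

Lemma sum_paired (V : zmodType) (F : nat -> V) i j : paired i j ->
  \sum_(p < L | X p == X i) F p = F i + F j.
Proof.
case=> /andP[lt_ij lt_jL] Xij Xonly; have lt_iL := ltn_trans lt_ij lt_jL.
rewrite (bigD1 (Ordinal lt_iL)) //= (bigD1 (Ordinal lt_jL)) /=; last first.
  by rewrite -Xij eqxx -val_eqE /= gtn_eqF.
rewrite big1 ?addr0 // => p /andP[/andP[/eqP/Xonly-/(_ (ltn_ord p)) pij]].
by rewrite -!val_eqE /=; case: pij => ->; rewrite eqxx.
Qed.

Lemma walkS nu p : walk nu p.+1 = walk nu p + sgp p * nu (X p).
Proof. by rewrite /walk big_ord_recr. Qed.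

Lemma walk_widen nu p : (p <= L)%N ->
  walk nu p = \sum_(l < L) (l < p)%N%:Z * sgp l * nu (X l).
Proof.
move=> le_pL; rewrite /walk (big_ord_widen L (fun l => sgp l * nu (X l))) //.
by rewrite big_mkcond; apply: eq_bigr => l _; case: ltnP; rewrite ?mul1r ?mul0r.
Qed.

(** Twice the part of the walk strictly between i and j equals the whole walk plus the inner part
    minus the outer part; [tau] collects the signs of the last two. *)
Definition tau i j (l : nat) : int :=
  if (l == i) || (l == j) then 0 else if (i < l < j)%N then sgp l else - sgp l.

(* The contributions of the positions i and j themselves cancel, which is why
   tau vanishes there. *)
Lemma pos_sub nu i j : (i < j < L)%N -> X i = X j ->
  2 * (pos nu j - pos nu i) =
  walk nu L + \sum_(l < L) tau i j l * nu (X l).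
Proof.
clear k_gt0; case/andP=> lt_ij lt_jL Xij; have lt_iL := ltn_trans lt_ij lt_jL.
rewrite /pos !walk_widen //; try by case: (s _); lia.
have ind (p : nat) : (p < L)%N -> \sum_(l < L) (l == p :> nat)%:Z * nu (X l) =
  nu (X p).
  move=> lt_p; rewrite (bigD1 (Ordinal lt_p)) //= eqxx mul1r big1 ?addr0 // => l.
  by rewrite -val_eqE /= => /negbTE->; rewrite mul0r.
(* Since X i = X j, the indicator of i minus that of j sums to 0 against [nu]. Adding this sum makes
   the identity hold term by term. *)
have := ind _ lt_iL; rewrite Xij -{}(ind _ lt_jL) => /eqP; rewrite -subr_eq0.
rewrite -sumrB => /eqP sum0; rewrite -sumrB mulr_sumr -big_split /=.
rewrite -[RHS]addr0 -[X in _ = _ + X]sum0 -big_split /=; apply: eq_bigr => l _.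
rewrite -mulrBl mulrA -[X in _ = _ + X]mulrBl -!mulrDl; congr (_ * _).
rewrite ltn_ord mul1r /tau.
have [->|l_neq_i] := eqVneq (l : nat) i.
  rewrite (ltn_eqF lt_ij) (ltn_addr _ lt_ij) /sgp.
  by case: (s i); rewrite /= ?addn1 ?addn0 ?ltnn ?ltnSn.
have [->|l_neq_j] := eqVneq (l : nat) j.
  have /leq_gtF-> : (i + s i <= j)%N by case: (s i); lia.
  by rewrite /sgp; case: (s j); rewrite /= ?addn1 ?addn0 ?ltnn ?ltnSn.
have -> : (l < j + s j)%N = (l < j)%N by case: (s j); lia.
have -> : (l < i + s i)%N = (l < i)%N by case: (s i); lia.
by rewrite /sgp /=; case: (s l); case: (ltngtP l i) l_neq_i => // ? _;
  case: (ltngtP l j) l_neq_j => // ? _ /=; lia.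
Qed.

Lemma norm_sum_le1 (P : pred nat) (F : nat -> int) : (forall l, `|F l| <= 1) ->
  `|\sum_(l < L | P l) F l| <= L%:Z.
Proof.
move=> F_le1; apply: le_trans (ler_norm_sum _ _ _) _.
apply: (@le_trans _ _ (\sum_(l < L) 1)); last by rewrite sumr_const card_ord natz.
by rewrite big_mkcond; apply: ler_sum => l _; case: ifP.
Qed.

Lemma sum_letters (R : comPzRingType) : exists Z, forall F f : nat -> R,
  \sum_(p < L) F p * f (X p) =
  (\sum_(p < L | X p == 0%N) F p) * f 0%N + (\sum_(p < L | X p == 1%N) F p) * f
    1%N +
  \sum_(z < Z) (\sum_(p < L | X p == z.+2) F p) * f z.+2.
Proof.
exists (\max_(p < L) X p).+1 => F f.
rewrite (@regroup _ _ _ (\max_(p < L) X p).+3) => [|p lt_pL].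
  by rewrite !big_ord_recl addrA.
have := @leq_bigmax 'I_L (fun p => X p) (Ordinal lt_pL).
by rewrite -ltnS => /leq_trans; apply; rewrite !ltnS leqW.
Qed.

Definition etau i j z : int := \sum_(l < L | X l == z) tau i j l.

Lemma pm_cases (F : nat -> int) a b : (F a = 1 \/ F a = -1) -> (F b = 1 \/ F b =
  -1) ->
  [\/ F a + F b = 0, F a + F b = 2 | F a + F b = -2].
Proof. by do 2!case=> ->; [apply: Or32 | apply: Or31 | apply: Or31 | apply:
  Or33]. Qed.

Lemma no_letter (V : zmodType) (F : nat -> V) z :
  ~ (exists2 p, (p < L)%N & X p = z) -> \sum_(l < L | X l == z) F l = 0.
Proof.
by move=> no_p; apply: big1 => l /eqP Xl; case: no_p; exists l.
Qed.

Lemma scount_cases z : quadr -> (1 < z)%N ->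
  [\/ scount z = 0, scount z = 2 | scount z = -2].
Proof.
move=> quad z_gt1; rewrite /scount.
have [[p lt_p Xp]|no_p] := pselect (exists2 p, (p < L)%N & X p = z); last first.
  by rewrite (no_letter sgp no_p); apply: Or31.
have [|i [j [ijP Xi]]] := quad p lt_p; first by rewrite Xp.
by rewrite -Xp -Xi (sum_paired sgp ijP); apply: pm_cases; apply: sgp_cases.
Qed.

(** A variable enters its own exponent difference only through the total [walk nu L]. Its exponent
    thus remains free for closing the walk. *)
Lemma etau_self i j : paired i j -> etau i j (X i) = 0.
Proof. by move=> ijP; rewrite /etau (sum_paired (tau i j) ijP) /tau !eqxx orbT. Qed.

Lemma etau_cases i j z : quadr -> paired i j -> (1 < z)%N ->
  [\/ etau i j z = 0, etau i j z = 2 | etau i j z = -2].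
Proof.
move=> quad ijP z_gt1; have [->|z_neq] := eqVneq z (X i).
  by rewrite etau_self //; apply: Or31.
rewrite /etau; have [[p lt_p Xp]|no_p] := pselect (exists2 p, (p < L)%N & X p = z);
  last by rewrite (no_letter (tau i j) no_p); apply: Or31.
have [|a [b [abP Xa]]] := quad p lt_p; first by rewrite Xp.
have [_ Xij _] := ijP; have [_ Xab _] := abP.
rewrite -Xp -Xa (sum_paired (tau i j) abP).
have tauP l : X l = z -> tau i j l = 1 \/ tau i j l = -1.
  move=> Xl; rewrite /tau ifN; last first.
    by rewrite negb_or; apply/andP; split; apply: contraNneq z_neq => lE;
      rewrite -Xl lE // Xij.
  by have [->|->] := sgp_cases l; case: ifP; rewrite ?opprK; auto.
by apply: pm_cases; apply: tauP; rewrite -?Xab Xa.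
Qed.

(** At an occurrence of b, [tau] is [sgp] up to sign, so both counts have the same parity. This lets
    integral exponents bring the difference exactly to 1 or 0. *)
Lemma etau1 i j : paired i j -> (1 < X i)%N ->
  exists m, etau i j 1%N = scount 1%N + 2 * m.
Proof.
move=> [_ Xij _] Xi_gt1.
exists (\sum_(l < L | X l == 1%N) if (i < l < j)%N then 0 else - sgp l).
rewrite /etau /scount mulr_sumr -big_split /=; apply: eq_bigr => l /eqP Xl.
rewrite /tau ifN; first by case: ifP => _; ring.
by rewrite negb_or; apply/andP; split; apply: contraTneq Xi_gt1 => lE;
  by (rewrite -lE Xl || rewrite Xij -lE Xl).
Qed.

Lemma etau1_le i j : `|etau i j 1%N| <= L%:Z.
Proof.
apply: (norm_sum_le1 (fun l => X l == 1%N)) => l; rewrite /tau.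
by have [->|->] := sgp_cases l; case: ifP => _ //; case: ifP.
Qed.

Lemma sum_etau0 nu i j : nu 0%N = 0 -> nu 1%N = 1 ->
  (forall z, (1 < z)%N -> etau i j z = 0) ->
  \sum_(l < L) tau i j l * nu (X l) = etau i j 1%N.
Proof.
move=> nu0 nu1 tau0; have [Z ->] := sum_letters int.
rewrite nu0 nu1 mulr0 mulr1 add0r [X in _ + X]big1 ?addr0 // => z _.
by have := tau0 z.+2 isT; rewrite /etau => ->; rewrite mul0r.
Qed.

(** A test assignment of exponents: z serves to prescribe an exponent difference, x to close the
    walk, and every other variable gets exponent 0. *)
Definition nu_pick z (t : int) x (t' : int) (y : nat) : int :=
  (y == 1%N)%:Z + t * (y == z)%:Z + t' * (y == x)%:Z.

Lemma sum_nu_pick (F : nat -> int) z t x t' :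
  \sum_(p < L) F p * nu_pick z t x t' (X p) =
  \sum_(p < L | X p == 1%N) F p + t * (\sum_(p < L | X p == z) F p)
  + t' * (\sum_(p < L | X p == x) F p).
Proof.
rewrite !mulr_sumr [\sum_(p < L | X p == 1%N) _]big_mkcond.
rewrite [\sum_(p < L | X p == z) _]big_mkcond [\sum_(p < L | X p == x) _]big_mkcond.
rewrite -!big_split /=; apply: eq_bigr => p _; rewrite /nu_pick.
by case: (X p == 1%N); case: (X p == z); case: (X p == x); rewrite /=; ring.
Qed.

Lemma normalized_pick mu nu z t x t' : (1 < z)%N -> (1 < x)%N ->
  normalized nu mu -> normalized (nu_pick z t x t') mu.
Proof.
case: z x => [|[|z]] [|[|x]] // _ _ [_ _ mu0 mu1 muP].
by split; rewrite // /nu_pick /= !mulr0.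
Qed.

Lemma apart_letters nu mu : exists Z, apart nu mu =
  coef nu 0%N * mu 0%N + coef nu 1%N * mu 1%N + \sum_(z < Z) coef nu z.+2 * mu z.+2.
Proof.
have [Z sumE] := sum_letters rat; exists Z.
by rewrite /apart (sumE (fun p => (sgp p)%:~R * kq ^ (- pos nu p))).
Qed.

Lemma apart_shift nu mu x t :
  apart nu (fun z => if z == x then mu z - t else mu z) = apart nu mu - coef nu
    x * t.
Proof.
rewrite /apart /coef mulr_suml [X in _ - X]big_mkcond -sumrB; apply: eq_bigr => p _.
by case: eqP => _; ring.
Qed.

(** The value is affine in [mu x] with slope [coef nu x]. If the slope is a unit times [M] and [M]
    divides the value, then subtracting the quotient, an element of Z[1/k], from [mu x] makes the
    value 0. *)
Lemma solve_along nu mu x (e : int) m M : (1 < x)%N -> normalized nu mu -> (e =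
  1 \/ e = -1) ->
  coef nu x = e%:~R * kq ^ m * M -> kideal k M (apart nu mu) ->
  exists2 mu', normalized nu mu' & apart nu mu' = 0.
Proof.
move=> x_gt1 [nu0 nu1 mu0 mu1 muP] e1 coefE [v vP apartE].
pose t := e%:~R * kq ^ (- m) * v.
exists (fun z => if z == x then mu z - t else mu z).
  split=> //; [by rewrite ltn_eqF // ltnW | by rewrite ltn_eqF | move=> z].
  case: eqP => // _; apply: kfracB => //; apply: kfracM => //.
  by apply: kfracM; [apply: kfrac_int | apply: kfrac_exp].
rewrite apart_shift coefE apartE /t.
have -> : e%:~R * kq ^ m * M * (e%:~R * kq ^ (- m) * v) =
  e%:~R * e%:~R * (kq ^ m * kq ^ (- m)) * (M * v) by ring.
by rewrite -kexpD // subrr expr0z; case: e1 => ->; ring.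
Qed.

(** Modulo k^g - 1 a power of k depends only on its exponent modulo g, and a common shift e of all
    the exponents multiplies the value by k^e. *)
Lemma apart_congr nu nu' mu (g e : int) : (forall z, kfrac k (mu z)) ->
  (forall p, (p < L)%N -> (g %| pos nu p - pos nu' p - e)%Z) ->
  kideal k (kq ^ g - 1) (apart nu' mu - kq ^ e * apart nu mu).
Proof.
move=> muP pos_congr; rewrite /apart mulr_sumr -sumrB; apply: kideal_sum => // p _.
have -> : (sgp p)%:~R * kq ^ (- pos nu' p) * mu (X p) -
   kq ^ e * ((sgp p)%:~R * kq ^ (- pos nu p) * mu (X p)) =
  (kq ^ (- pos nu' p) - kq ^ (e - pos nu p)) * ((sgp p)%:~R * mu (X p)).
  by rewrite kexpD //; ring.
apply: kidealMr => //; last by apply: kfracM => //; apply: kfrac_int.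
apply: kideal_subX_congr => //; have := pos_congr p (ltn_ord p).
by congr (_ %| _)%Z; ring.
Qed.

Lemma coef_paired nu i j : paired i j ->
  coef nu (X i) =
  (sgp i)%:~R * kq ^ (- pos nu j) * (kq ^ (pos nu j - pos nu i) + (sgp i * sgp
    j)%:~R).
Proof.
move=> ijP; rewrite /coef (sum_paired (fun p =>
  (sgp p)%:~R * kq ^ (- pos nu p)) ijP).
rewrite mulrDr -mulrA -kexpD // addrA addNr add0r; congr (_ + _).
have [->|->] := sgp_cases i; have [->|->] := sgp_cases j; by rewrite ?intrM /=;
  ring.
Qed.
End Positions.

(** * Lifting solutions modulo a computable number to solutions over Z[1/k] *)

Lemma dvdz_small (d z : int) : (d %| z)%Z -> `|z| < `|d| -> z = 0.
Proof.
rewrite dvdzE => d_dvd z_lt; apply/eqP; apply: contraTT z_lt => z_neq0.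
by rewrite -leNgt -!abszE lez_nat dvdn_leq // absz_gt0.
Qed.

(** Pigeonhole: L + 1 residues cannot meet all of L + 2 disjoint blocks of length D. The origin is
    moved to the end of a block that is missed. *)
Lemma circle_gap (L D g : nat) (r : nat -> int) : (0 < D)%N -> (L.+2 * D <= g)%N ->
  exists s : int, forall p, (p <= L)%N -> ((r p - s) %% g)%Z + D%:Z < g%:Z.
Proof.
move=> D_gt0 le_g; have g_gt0 : (0 < g)%N by apply: leq_trans le_g;
  rewrite muln_gt0.
pose res p := `|(r p %% g)%Z|%N.
have resP p : r p = (r p %/ g)%Z * g%:Z + (res p)%:Z /\ (res p < g)%N.
  have modP : 0 <= (r p %% g)%Z < g%:Z by rewrite modz_ge0 ?ltz_pmod //; lia.
  rewrite /res; move: (divz_eq (r p) g); lia.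
have [i i_out] : exists i : 'I_L.+2, forall p, (p <= L)%N -> (res p %/ D)%N != i.
  (* [inord] sends block numbers above L + 1 to 0; this is harmless, since only a block with number
     at most L + 1 is to be avoided. *)
  pose f (p : 'I_L.+1) : 'I_L.+2 := inord (res p %/ D).
  have [i i_out] : exists i, i \notin codom f.
    apply/existsP; rewrite -negb_forall; apply/negP => /forallP f_onto.
    have: (#|'I_L.+2| <= #|codom f|)%N by apply/subset_leq_card/subsetP => i _.
    by move/leq_trans/(_ (leq_image_card _ _)); rewrite !card_ord ltnn.
  exists i => p le_pL; apply: contraNneq i_out => resE.
  apply/codomP; exists (Ordinal (le_pL : (p < L.+1)%N)).
  by rewrite /f /= resE inord_val.
exists ((i.+1 * D)%N%:Z) => p le_pL.
have [rE res_lt] := resP p; have := i_out p le_pL; rewrite rE.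
move: (r p %/ g)%Z (res p) res_lt => q m lt_m m_out; have lt_i := ltn_ord i.
have le_iD : (i.+1 * D <= g)%N by apply: leq_trans le_g;
  rewrite leq_mul2r lt_i orbT.
have [lt_mi|le_im] := ltnP m (i * D).
  have -> : q * g%:Z + m%:Z - (i.+1 * D)%N%:Z =
      (q - 1) * g%:Z + (g + m - i.+1 * D)%N%:Z by rewrite -subzn; lia.
  by rewrite modzMDl modz_small; lia.
have le_im' : (i.+1 * D <= m)%N.
  by move: m_out; rewrite -leq_divRL // ltn_neqAle leq_divRL // le_im andbT eq_sym.
have -> : q * g%:Z + m%:Z - (i.+1 * D)%N%:Z = q * g%:Z + (m - i.+1 * D)%N%:Z.
  by rewrite -subzn //; lia.
by rewrite modzMDl modz_small; lia.
Qed.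

Section Core.
Variables (k L : nat) (X : nat -> nat) (s : nat -> bool).
Hypothesis k_gt0 : (0 < k)%N.
Hypothesis quad : quadr L X.

Notation kq := (k%:R : rat).
Notation sgp := (sgp s).
Notation walk := (walk X s).
Notation pos := (pos X s).
Notation apart := (apart k L X s).
Notation coef := (coef k L X s).
Notation scount := (scount L X s).
Notation etau := (etau L X s).
Notation normalized := (normalized k).
Notation paired := (paired L X).

(* If opposite occurrences agree modulo g, cutting the circle Z/g at an arc
   avoided by all the prefixes lifts the closed walk to a closed walk in Z
   confined to an interval shorter than g. *)
Lemma unwind nu mu (D g : nat) : (0 < D)%N -> (L.+2 * D <= g)%N ->
  normalized nu mu -> (g%:Z %| walk nu L)%Z ->
  (forall p p', (p < L)%N -> (p' < L)%N -> (1 < X p)%N -> X p = X p' ->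
     (g%:Z %| pos nu p - pos nu p')%Z) ->
  exists nu', [/\ normalized nu' mu, walk nu' L = 0,
    forall p p', (p < L)%N -> (p' < L)%N -> (1 < X p)%N -> X p = X p' ->
     pos nu' p = pos nu' p' &
    exists r e : int, forall p, (p < L)%N -> 0 <= pos nu' p + r < g%:Z - D%:Z /\
      (g%:Z %| pos nu p - pos nu' p - e)%Z].
Proof.
move=> D_gt0 le_g [nu0 nu1 mu0 mu1 muP] closed agree.
have [c gap] := circle_gap (walk nu) D_gt0 le_g.
have g_gt0 : (0 < g)%N by apply: leq_trans le_g; rewrite muln_gt0.
(* The representative in [0, g) measured from the cut [c]. *)
pose lam (m : int) := ((m - c) %% g)%Z.
have lamP m : 0 <= lam m < g by rewrite modz_ge0 ?ltz_pmod //; lia.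
have lam_uniq m v : 0 <= v < g%:Z -> (g%:Z %| m - c - v)%Z -> lam m = v.
  move=> v_lt /dvdzP[x mE]; rewrite /lam.
  by have -> : m - c = x * g%:Z + v by [lia]; rewrite modzMDl modz_small.
have lam_congr m : (g%:Z %| m - c - lam m)%Z.
  by apply/dvdzP; exists ((m - c) %/ g)%Z; move: (divz_eq (m - c) g);
    rewrite /lam; lia.
have lam_eq m m' : (g%:Z %| m - m')%Z -> lam m = lam m'.
  move=> dvd_m; apply: lam_uniq => //; have := rpredD dvd_m (lam_congr m').
  by congr (_ %| _)%Z; ring.
have lam_gap p : (p <= L)%N -> lam (walk nu p) + D%:Z < g%:Z by move/gap.
(* The prefixes [pos nu p] and [walk nu (p + ~~ s p)] are the two ends of the letter at p. The new
   exponent of a variable is the lifted difference at one of its occurrences; by [agree] all of them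
   give the same value. *)
pose nu' y := if y == 0%N then 0 else if y == 1%N then 1 else
  if [pick p : 'I_L | X p == y] is Some p then
    lam (walk nu (p + ~~ s p)) - lam (pos nu p) else 0.
have step p : (p < L)%N ->
    sgp p * nu' (X p) = lam (walk nu p.+1) - lam (walk nu p).
  move=> lt_pL; rewrite /nu'; have [Xp|Xp0] := eqVneq (X p) 0%N.
    by rewrite walkS Xp nu0 !mulr0 addr0 subrr.
  have [Xp|Xp1] := eqVneq (X p) 1%N.
    (* No prefix lies within [D] of the upper end, so a step along b does not cross the cut and
       lifts to exactly 1 or -1. *)
    have := lam_gap p (ltnW lt_pL); have := lam_gap p.+1 lt_pL.
    rewrite walkS Xp nu1 mulr1; move: (walk nu p) => m.
    have [->|->] := sgp_cases s p => lt_m1 lt_m.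
      rewrite (lam_uniq (m + 1) (lam m + 1)); first by ring.
        by have := lamP m; lia.
      by have := lam_congr m; congr (_ %| _)%Z; ring.
    rewrite (lam_uniq m (lam (m - 1) + 1)); first by ring.
      by have := lamP (m - 1); lia.
    by have := lam_congr (m - 1); congr (_ %| _)%Z; ring.
  case: pickP => [p' /eqP Xp'|/(_ (Ordinal lt_pL))]; last by rewrite /= eqxx.
  have Xp_gt1 : (1 < X p)%N by move: Xp0 Xp1; lia.
  have pp' := agree p p' lt_pL (ltn_ord p') Xp_gt1 (esym Xp').
  rewrite -(lam_eq _ _ pp') -(lam_eq (walk nu (p + ~~ s p)) (walk nu (p' + ~~ s
    p'))).
    by rewrite /pos /sgp; case: (s p); rewrite /= ?addn1 ?addn0; ring.
  have endE r : walk nu (r + ~~ s r) = pos nu r + nu (X r).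
    by rewrite /pos; have := walkS X s nu r; rewrite /sgp; case: (s r) => /=;
      rewrite ?addn1 ?addn0 => ->; ring.
  by rewrite !endE Xp'; congr (_ %| _)%Z: pp'; ring.
have walk' p : (p <= L)%N -> walk nu' p = lam (walk nu p) - lam 0.
  elim: p => [|p IHp] lt_pL; first by rewrite /walk !big_ord0 subrr.
  by rewrite walkS IHp 1?ltnW // step //; ring.
have walk_nu0 : walk nu 0 = 0 by rewrite /walk big_ord0.
have pos' p : (p < L)%N -> pos nu' p = lam (pos nu p) - lam 0.
  by move=> lt_pL; rewrite /pos walk' //; case: (s p); lia.
exists nu'; split.
- by split.
- rewrite walk' // (lam_eq _ 0) ?subrr //.
  by rewrite subr0.
- move=> p p' lt_p lt_p' Xp_gt1 Xpp'; rewrite !pos' //.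
  by rewrite (lam_eq _ _ (agree p p' lt_p lt_p' Xp_gt1 Xpp')).
exists (lam 0), (lam 0 + c) => p lt_pL; rewrite pos' // subrK; split.
  have le_p : (p + s p <= L)%N by case: (s p); lia.
  by have := lam_gap _ le_p; have := lamP (pos nu p); rewrite /pos; lia.
by have := lam_congr (pos nu p); congr (_ %| _)%Z; ring.
Qed.

Lemma exp_Posz (m n : nat) : m%:Z ^+ n = (m ^ n)%N%:Z.
Proof. by elim: n => // n IHn; rewrite exprS expnS PoszM IHn. Qed.

Lemma coprime_predX g : (0 < g)%N -> coprime (k ^ g).-1 k.
Proof.
move=> g_gt0; rewrite -(coprime_pexpr _ _ g_gt0).
by rewrite -{2}(prednK (n := k ^ g)) ?expn_gt0 ?k_gt0 // coprimenS.
Qed.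

Lemma predX_rat g : ((k ^ g).-1)%:R = kq ^ g%:Z - 1 :> rat.
Proof. by rewrite -subn1 natrB ?expn_gt0 ?k_gt0 // natrX. Qed.

(** The occurrences of each variable have equal exponents and opposite signs, so they cancel and
    only the letters a remain. Scaled by a power of k, their sum is an integer divisible by k^g - 1
    and smaller than it in absolute value, hence 0. *)
Lemma unwound_apart nu mu (D g : nat) (r : int) : (L < D <= g)%N -> (1 < k)%N ->
  normalized nu mu -> (forall z, (1 < z)%N -> scount z = 0) ->
  (forall p p', (p < L)%N -> (p' < L)%N -> (1 < X p)%N -> X p = X p' ->
     pos nu p = pos nu p') ->
  (forall p, (p < L)%N -> 0 <= pos nu p + r < g%:Z - D%:Z) ->
  kideal k (kq ^ g%:Z - 1) (apart nu mu) -> apart nu mu = 0.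
Proof.
move=> /andP[lt_LD le_Dg] k_gt1 [nu0 nu1 mu0 mu1 muP] opp agree range apart_ideal.
have apartE : apart nu mu = coef nu 0%N.
  have [Z ->] := apart_letters k L X s nu mu; rewrite mu0 mu1 mulr1 mulr0 addr0.
  rewrite big1 ?addr0 // => z _.
  have [[p lt_p Xp]|no_p] := pselect (exists2 p, (p < L)%N & X p = z.+2);
    last first.
    by rewrite /coef (no_letter (fun p =>
      (sgp p)%:~R * kq ^ (- pos nu p)) no_p) mul0r.
  rewrite /coef (eq_bigr (fun l : 'I_L => (sgp l)%:~R * kq ^ (- pos nu p))).
    rewrite -mulr_suml -(rmorph_sum (intmul (1 : rat))).
    by have := opp z.+2 isT; rewrite /scount => ->; rewrite !mul0r.
  by move=> l /eqP Xl; rewrite (agree l p) // ?Xl ?Xp.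
(* By [range] the number under the absolute value is positive and at most g - D. Thus scaling by
   k^(g - D - r) makes every term an integer of size at most k^(g - D). *)
pose n p := `|(g%:Z - D%:Z - (pos nu p + r))%R|%N.
pose S : int := \sum_(p < L | X p == 0%N) sgp p * k%:Z ^+ n p.
have SE : S%:~R = kq ^ (g%:Z - D%:Z - r) * apart nu mu.
  rewrite apartE /coef mulr_sumr rmorph_sum; apply: eq_bigr => p _ /=.
  rewrite rmorphM rmorphXn /= mulrCA -kexpD //; congr (_ * _).
  have := range p (ltn_ord p) => range_p.
  by rewrite exprnP /n gez0_abs; [congr (_ ^ _); ring | lia].
have S_lt : `|S| < k%:Z ^+ g - 1.
  apply: (@le_lt_trans _ _ (\sum_(p < L) k%:Z ^+ (g - D))).
    apply: le_trans (ler_norm_sum _ _ _) _; rewrite big_mkcond.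
    apply: ler_sum => p _; case: ifP => _; last by rewrite exprn_ge0.
    have -> : `|sgp p * k%:Z ^+ n p| = k%:Z ^+ n p.
      by rewrite normrM normrX; have [->|->] := sgp_cases s p;
        rewrite ?normrN normr1 mul1r.
    rewrite ler_eXn2l; last by lia.
    by have := range p (ltn_ord p); rewrite /n; lia.
  rewrite sumr_const card_ord -(subnK le_Dg) addnK exprD.
  (* This bound keeps L terms of size k^(g - D) below k^g - 1. *)
  have L_lt : (L.+1 * 2 <= k ^ D)%N.
    apply: (@leq_trans (k ^ L.+1)); last by rewrite leq_exp2l.
    by rewrite expnSr leq_mul // ltn_expl.
  have a_gt0 : (0 < k ^ (g - D))%N by rewrite expn_gt0 k_gt0.
  have -> : k%:Z ^+ (g - D) *+ L = (k ^ (g - D) * L)%N%:Z.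
    by rewrite -mulr_natr PoszM natz exp_Posz.
  have -> : k%:Z ^+ (g - D) * k%:Z ^+ D - 1 = (k ^ (g - D) * k ^ D)%N%:Z - 1.
    by rewrite PoszM !exp_Posz.
  by nia.
have N_dvd : (((k ^ g).-1)%:Z %| S)%Z.
  apply: (kideal_natP k_gt0); first by rewrite coprime_predX //; lia.
  by rewrite predX_rat SE; apply: kidealMl => //; apply: kfrac_exp.
have S0 : S = 0.
  apply: (dvdz_small N_dvd); apply: lt_le_trans S_lt _.
  by rewrite exp_Posz; lia.
by move/eqP: SE; rewrite S0 eq_sym mulf_eq0 (negbTE (kexp_neq0 k_gt0 _)) => /eqP.
Qed.

Variable c : nat.
Hypothesis le_Lc : (L <= c)%N.

(* 2 * radius replaces the exponents of b and modulus the ring Z[1/k]: radius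
   is divisible by every nonzero exponent that occurs, and leaves room for the
   gap needed in unwind. If k = 1 the number k ^ radius - 1 vanishes; then any
   even number above the length of the word does. *)
Definition radius : nat := c.+2`!.
Definition modulus : nat := if k == 1%N then c.+1.*2 else (k ^ radius).-1.
Notation g := radius.
Notation N := modulus.

(** The room that [unwind] requires for a gap of length L + 1. *)
Lemma radius_ge : (L.+2 * L.+1 <= g)%N.
Proof.
rewrite /radius; apply: (@leq_trans (c.+2 * c.+1)); first by rewrite leq_mul.
by rewrite factS leq_mul2l /= dvdn_leq ?fact_gt0 ?dvdn_fact //=.
Qed.

Lemma dvd_radius (d : int) : d != 0 -> `|d| <= L%:Z -> (d %| g%:Z)%Z.
Proof.
move=> d_neq0 d_le; rewrite dvdzE absz_nat; apply: dvdn_fact.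
by rewrite absz_gt0 d_neq0 /=; lia.
Qed.

Lemma modulus_dvd (d : int) : (1 < k)%N -> d != 0 -> `|d| <= L%:Z ->
  kideal k (kq ^ d - 1) N%:R.
Proof.
move=> k_gt1 d_neq0 d_le; rewrite /modulus gtn_eqF // predX_rat.
by apply: kideal_subX => //; apply: dvd_radius.
Qed.

Lemma modulus2 : kideal k 2 N%:R.
Proof.
rewrite /modulus; case: eqP => [_|/eqP k_neq1].
  exists c.+1%:R; first exact: kfrac_nat.
  by rewrite -mul2n natrM.
rewrite predX_rat; apply: kideal_trans (kideal2_pred k_gt0) _.
by rewrite -[X in kideal k (X - 1)](expr1z kq); apply: kideal_subX => //;
  apply: dvd1z.
Qed.

Lemma modulus_pred : (1 < k)%N -> kideal k (kq - 1) N%:R.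
Proof.
move=> k_gt1; rewrite /modulus gtn_eqF // predX_rat.
by rewrite -[X in kideal k (X - 1)](expr1z kq); apply: kideal_subX => //;
  apply: dvd1z.
Qed.

Lemma walk_letters nu : nu 0%N = 0 -> nu 1%N = 1 -> exists Z,
  walk nu L = scount 1%N + \sum_(z < Z) scount z.+2 * nu z.+2.
Proof.
move=> nu0 nu1; have [Z sumE] := sum_letters L X int; exists Z.
by rewrite /walk (sumE sgp) nu0 nu1 mulr0 add0r mulr1.
Qed.

(** Modulo k - 1 all powers of k are 1, so the value does not depend on the exponents. *)
Lemma apart_mod_pred nu nu' mu : (forall z, kfrac k (mu z)) ->
  kideal k (kq - 1) (apart nu' mu - apart nu mu).
Proof.
move=> muP; have -> : apart nu' mu - apart nu mu = apart nu' mu - kq ^ 0 * apart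
  nu mu.
  by rewrite expr0z mul1r.
rewrite -[X in kideal k (X - 1)](expr1z kq).
by apply: apart_congr => // p _; apply: dvd1z.
Qed.

Definition solved := exists nu mu, [/\ normalized nu mu,
  walk nu L = 0 & apart nu mu = 0].

(** Each variable occurs with opposite signs, so the walk ends at the exponent sum of b for every
    choice of exponents, and coefficients are k^d - 1 up to a unit. Either all differences d vanish
    modulo g and the walk is unwound, or some variable has a coefficient that can be made a divisor
    of [N], and the equation is solved along it. *)
Lemma solve_orientable nu mu : normalized nu mu -> (2 * g%:Z %| walk nu L)%Z ->
  kideal k N%:R (apart nu mu) -> (forall z, (1 < z)%N -> scount z = 0) -> solved.
Proof.
move=> norm closed apartN opp; have [nu0 nu1 mu0 mu1 muP] := norm.
have walkE (f : nat -> int) : f 0%N = 0 -> f 1%N = 1 -> walk f L = scount 1%N.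
  move=> f0 f1; have [Z ->] := walk_letters f0 f1.
  by rewrite big1 ?addr0 // => z _; rewrite opp ?mul0r.
have scount_le z : `|scount z| <= L%:Z.
  apply: (norm_sum_le1 L (fun l => X l == z)) => l.
  by have [->|->] := sgp_cases s l.
(* The exponent sum of b is at most L in absolute value and divisible by 2g. *)
have T0 : scount 1%N = 0.
  apply: (@dvdz_small (2 * g%:Z)); first by rewrite -(walkE nu).
  by have := scount_le 1%N; have := radius_ge; nia.
(* For k = 1 the value is the exponent sum of a, which is at most L < [N] in absolute value and
   divisible by [N]. *)
have [k1|k_neq1] := eqVneq k 1%N.
  exists nu, mu; split; rewrite ?walkE //.
  have kq1 m : kq ^ m = 1 by rewrite k1 exp1rz.
  have [Z apartE] := apart_letters k L X s nu mu.
  have coefE z : coef nu z = (scount z)%:~R.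
    rewrite /coef /scount rmorph_sum; apply: eq_bigr => p _.
    by rewrite /= kq1 mulr1.
  have {}apartE : apart nu mu = (scount 0%N)%:~R.
    rewrite apartE mu0 mu1 mulr0 mulr1 addr0 coefE big1 ?addr0 // => z _.
    by rewrite coefE opp ?mul0r.
  have copNk : coprime N k by rewrite [X in coprime _ X]k1 coprimen1.
  move: apartN; rewrite apartE => /(kideal_natP k_gt0 copNk)/dvdz_small-> //.
  by have := scount_le 0%N; rewrite /modulus k1 /=; lia.
have k_gt1 : (1 < k)%N by lia.
have [agree|] := pselect (forall p p', (p < L)%N -> (p' < L)%N -> (1 < X p)%N ->
    X p = X p' -> (g%:Z %| pos nu p - pos nu p')%Z).
  have [|nu' [norm' walk0 agree' [r [e rangeP]]]] := unwind (ltn0Sn L) radius_ge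
    norm _ agree.
    by apply: dvdz_trans closed; apply: dvdz_mull.
  exists nu', mu; split=> //.
  apply: (unwound_apart (D := L.+1) (g := g) (r := r)) norm' opp agree' _ _ => //.
  - by rewrite ltnSn; have := radius_ge; nia.
  - by move=> p /rangeP[].
  have apart_ideal : kideal k (kq ^ g%:Z - 1) (apart nu mu).
    by move: apartN; rewrite /modulus (negbTE k_neq1) predX_rat.
  rewrite -(subrK (kq ^ e * apart nu mu) (apart nu' mu)); apply: kidealD => //.
    by apply: apart_congr => // p /rangeP[].
  by apply: kidealMl => //; apply: kfrac_exp.
move=> disagree.
have [p1 [p2 [lt_p1 lt_p2 Xp_gt1 Xp1p2 ndvd]]] : exists p1 p2,
    [/\ (p1 < L)%N, (p2 < L)%N, (1 < X p1)%N, X p1 = X p2 &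
    ~~ (g%:Z %| pos nu p1 - pos nu p2)%Z].
  apply: contrapT => no_p; apply: disagree => p p' lt_p lt_p' Xp_gt1 Xpp'.
  by apply: contrapT => /negP ndvd; apply: no_p; exists p, p'.
have [i [j [ijP Xi]]] := quad lt_p1 Xp_gt1.
have [lt_ijL Xij only] := ijP.
have Xi_gt1 : (1 < X i)%N by rewrite Xi.
have sgij : sgp i * sgp j = -1.
  have := opp (X i) Xi_gt1; rewrite /scount (sum_paired sgp ijP).
  by have [->|->] := sgp_cases s i; have [->|->] := sgp_cases s j.
have d_ndvd : ~~ (g%:Z %| pos nu j - pos nu i)%Z.
  have [] := only p1 lt_p1 (esym Xi);
    have [] := only p2 lt_p2 (etrans (esym Xp1p2) (esym Xi));
    move=> E2 E1; move: ndvd; rewrite E1 E2 ?subrr ?dvdz0 //.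
  by rewrite -opprB rpredN.
have coefE f : coef f (X i) =
    (sgp i)%:~R * kq ^ (- pos f j) * (kq ^ (pos f j - pos f i) - 1).
  by rewrite (coef_paired s k_gt0 f ijP) sgij.
have pos_subE (f : nat -> int) : f 0%N = 0 -> f 1%N = 1 ->
    2 * (pos f j - pos f i) = \sum_(l < L) tau s i j l * f (X l).
  by move=> f0 f1; rewrite (pos_sub s f lt_ijL Xij) walkE // T0 add0r.
have finish f : normalized f mu ->
    kideal k (kq ^ (pos f j - pos f i) - 1) (apart f mu) -> solved.
  move=> normf apartf; have [f0 f1 _ _ _] := normf.
  have [mu' norm' apart0] := solve_along k_gt0 Xi_gt1 normf (sgp_cases s i)
    (coefE f) apartf.
  by exists f, mu'; split; rewrite ?walkE.
(* In the first case 2d does not depend on the exponents of the variables, so |2d| <= L. Moreover d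
   is nonzero because g does not divide it, and k^d - 1 divides [N]. *)
have [all0|] := pselect (forall z, (1 < z)%N -> etau i j z = 0).
  apply: (finish nu) => //; apply: kideal_trans apartN => //.
  have := pos_subE nu nu0 nu1; rewrite (sum_etau0 nu0 nu1 all0) => dE.
  have := etau1_le L X s i j; rewrite -dE => d_le.
  apply: modulus_dvd => //; last by lia.
  by apply: contraNneq d_ndvd => ->; apply: dvdz0.
move=> not_all0.
have [z z_gt1 tau_z] : exists2 z, (1 < z)%N & etau i j z != 0.
  apply: contrapT => no_z; apply: not_all0 => z z_gt1.
  by apply: contrapT => /eqP tz; apply: no_z; exists z.
have [m mE] := etau1 s ijP Xi_gt1.
(* The solution of 2m + t [etau i j z] = 2, which makes d = 1 and the coefficient k - 1 up to a
   unit. *)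
pose t := if etau i j z == 2 then 1 - m else m - 1.
have normf := normalized_pick t 0 z_gt1 z_gt1 norm.
apply: (finish _ normf); have [f0 f1 _ _ _] := normf.
have := pos_subE _ f0 f1; rewrite (sum_nu_pick _ _ (tau s i j)) -!/(etau _ _ _)
  mE T0.
have d1 : 0 + 2 * m + t * etau i j z + 0 * etau i j z = 2.
  by rewrite /t; have [] := etau_cases s quad ijP z_gt1 => E;
    rewrite E in tau_z *; rewrite //=; ring.
rewrite d1 => dE; have -> : pos (nu_pick z t z 0) j - pos (nu_pick z t z 0) i =
  1 by lia.
(* The exponents have changed, but modulo k - 1, a divisor of [N], the value has not. *)
rewrite expr1z; apply: (kideal_congr k_gt0 (apart_mod_pred nu _ muP)).
exact: kideal_trans (modulus_pred k_gt1) apartN.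
Qed.

(** Here x occurs twice with the same sign, so its coefficient is k^d + 1 up to a unit, while its
    exponent can be used to close the walk. If d is constant, then k^d + 1 divides [N]; otherwise d
    is made 0 and the coefficient 2. *)
Lemma solve_nonorientable nu mu x : normalized nu mu -> (2 * g%:Z %| walk nu L)%Z ->
  kideal k N%:R (apart nu mu) -> (1 < x)%N -> scount x != 0 -> solved.
Proof.
move=> norm closed apartN x_gt1 x_neq0; have [nu0 nu1 mu0 mu1 muP] := norm.
have [i [j [ijP Xi]]] : exists i j, paired i j /\ X i = x.
  have [p lt_p Xp] : exists2 p, (p < L)%N & X p = x.
    by apply: contrapT => no_p; case/eqP: x_neq0; apply: no_letter.
  by rewrite -Xp; apply: quad => //; rewrite Xp.
have [lt_ijL Xij only] := ijP.
have Xi_gt1 : (1 < X i)%N by rewrite Xi.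
have sgij : sgp i * sgp j = 1.
  move: x_neq0; rewrite -Xi /scount (sum_paired sgp ijP).
  by have [->|->] := sgp_cases s i; have [->|->] := sgp_cases s j.
have x2 : scount x = 2 \/ scount x = -2.
  by have [] := scount_cases s quad x_gt1 => E; rewrite E in x_neq0 *; auto.
have coefE f : coef f (X i) =
    (sgp i)%:~R * kq ^ (- pos f j) * (kq ^ (pos f j - pos f i) + 1).
  by rewrite (coef_paired s k_gt0 f ijP) sgij.
have finish f : normalized f mu -> walk f L = 0 ->
    kideal k (kq ^ (pos f j - pos f i) + 1) (apart f mu) -> solved.
  move=> normf walk0 apartf.
  have [mu' norm' apart0] := solve_along k_gt0 Xi_gt1 normf (sgp_cases s i)
    (coefE f) apartf.
  by exists f, mu'.
have [all0|] := pselect (forall z, (1 < z)%N -> etau i j z = 0).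
  have [q qE] := dvdzP closed.
  (* The walk ends at 2qg and changes by t times [scount x], which is 2 or -2. Having the closing
     condition modulo 2g makes t a multiple of g, so the value modulo [N] is unaffected. *)
  pose t := if scount x == 2 then - (q * g%:Z) else q * g%:Z.
  pose f y := nu y + t * (y == x)%:Z.
  have normf : normalized f mu.
    split; rewrite // /f; [have -> : (0%N == x) = false by lia | have -> : (1%N
      == x) = false by lia];
      by rewrite mulr0 addr0.
  have [f0 f1 _ _ _] := normf.
  have walkf p : walk f p = walk nu p + t * \sum_(l < p) sgp l * (X l == x)%:Z.
    rewrite /walk mulr_sumr -big_split; apply: eq_bigr => l _ /=.
    by rewrite /f; ring.
  have walk0 : walk f L = 0.
    rewrite walkf qE; have -> : \sum_(l < L) sgp l * (X l == x)%:Z = scount x.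
      rewrite /scount [RHS]big_mkcond; apply: eq_bigr => l _.
      by case: (X l == x); rewrite ?mulr1 ?mulr0.
    by rewrite /t; case: x2 => ->; rewrite /=; ring.
  have apartf : kideal k N%:R (apart f mu).
    have [k1|k_neq1] := eqVneq k 1%N.
      suff -> : apart f mu = apart nu mu by [].
      by apply: eq_bigr => p _; rewrite k1 !exp1rz.
    have NE : N%:R = kq ^ g%:Z - 1 by rewrite /modulus (negbTE k_neq1) predX_rat.
    rewrite -(subrK (kq ^ 0 * apart nu mu) (apart f mu)); apply: kidealD => //;
      last first.
      by rewrite expr0z mul1r.
    rewrite NE; apply: apart_congr => // p _; rewrite /pos walkf subr0.
    rewrite opprD addrA subrr add0r rpredN; apply: dvdz_mulr.
    by rewrite /t; case: ifP => _; rewrite ?rpredN; apply: dvdz_mull.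
  apply: (finish f) => //; apply: kideal_trans apartf => //.
  have dE := pos_sub s f lt_ijL Xij;
    rewrite walk0 add0r (sum_etau0 f0 f1 all0) in dE.
  have := etau1_le L X s i j; rewrite -dE; move: (pos f j - pos f i) => d d_le.
  have [->|d_neq0] := eqVneq d 0; first by rewrite expr0z; apply: modulus2.
  have [k1|k_neq1] := eqVneq k 1%N.
    by rewrite {2}k1 exp1rz; apply: modulus2.
  (* k^d + 1 divides k^(2d) - 1, and 0 < |2d| <= L. *)
  apply: (@kideal_trans _ (kq ^ (2 * d) - 1)); last first.
    by apply: modulus_dvd => //; lia.
  exists (kq ^ d - 1); first by apply: kfracB => //;
    [apply: kfrac_exp | apply: kfrac1].
  have -> : 2 * d = d + d by ring.
  by rewrite kexpD //; ring.
move=> not_all0.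
have [z z_gt1 tau_z] : exists2 z, (1 < z)%N & etau i j z != 0.
  apply: contrapT => no_z; apply: not_all0 => z z_gt1.
  by apply: contrapT => /eqP tz; apply: no_z; exists z.
have [m mE] := etau1 s ijP Xi_gt1.
(* The end of the walk and the exponent sums of all variables are even, hence so is that of b. *)
have [T TE] : exists T, scount 1%N = 2 * T.
  have [q qE] := dvdzP closed; have [Z walkE] := walk_letters nu0 nu1.
  have sumE : exists r, \sum_(z < Z) scount z.+2 * nu z.+2 = 2 * r.
    elim/big_ind: _ => [|_ _ [r1 ->] [r2 ->]|y _]; first by exists 0.
      by exists (r1 + r2); ring.
    have [] := scount_cases s quad (isT : 1 < y.+2)%N => ->.
    - by exists 0; ring.
    - by exists (nu y.+2).
    - by exists (- nu y.+2); ring.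
  have [r rE] := sumE; exists (q * g%:Z - r).
  by move: walkE; rewrite qE rE => walkE; rewrite -[LHS](addrK (2 * r)) -walkE;
    ring.
(* The solution of 2T + 2m + t [etau i j z] = 0, so that d = 0 once the walk is closed. *)
pose t := if etau i j z == 2 then - (T + m) else T + m.
have [u uE] : exists u, scount z = 2 * u.
  by have [] := scount_cases s quad z_gt1 => ->;
    [exists 0 | exists 1 | exists (-1)].
(* Closes the walk by means of x, which leaves d alone because [etau i j x] = 0. *)
pose t' := if scount x == 2 then - (T + t * u) else T + t * u.
have normf := normalized_pick t t' z_gt1 x_gt1 norm.
have walk0 : walk (nu_pick z t x t') L = 0.
  rewrite /walk (sum_nu_pick L X sgp) -!/(scount _) TE uE /t'.
  by case: x2 => ->; rewrite /=; ring.
apply: (finish _ normf walk0).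
have dE := pos_sub s (nu_pick z t x t') lt_ijL Xij; rewrite walk0 add0r in dE.
rewrite (sum_nu_pick L X (tau s i j)) -!/(etau _ _ _) mE TE in dE.
have tau_x : etau i j x = 0 by rewrite -Xi etau_self.
have d0 : 2 * T + 2 * m + t * etau i j z + t' * etau i j x = 0.
  rewrite tau_x mulr0 addr0 /t.
  by have [] := etau_cases s quad ijP z_gt1 => E; rewrite E in tau_z *;
    rewrite //=; ring.
rewrite d0 in dE.
have -> : pos (nu_pick z t x t') j - pos (nu_pick z t x t') i = 0 by lia.
rewrite expr0z; apply: (kideal_congr k_gt0 (v := apart nu mu)).
  by apply: kideal_trans (kideal2_pred k_gt0) (apart_mod_pred _ _ muP).
exact: kideal_trans modulus2 apartN.
Qed.

Lemma solve_mod nu mu : normalized nu mu -> (2 * g%:Z %| walk nu L)%Z ->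
  kideal k N%:R (apart nu mu) -> solved.
Proof.
move=> norm closed apartN.
have [opp|nopp] := pselect (forall z, (1 < z)%N -> scount z = 0).
  exact: solve_orientable norm closed apartN opp.
have [x x_gt1 x_neq0] : exists2 x, (1 < x)%N & scount x != 0.
  apply: contrapT => no_x; apply: nopp => x x_gt1.
  by apply: contrapT => /eqP x0; apply: no_x; exists x.
exact: solve_nonorientable norm closed apartN x_gt1 x_neq0.
Qed.
End Core.

(** * The solvable Baumslag-Solitar group as an affine group *)

Section BaumslagSolitar.
Variable k : nat.
Hypothesis k_gt0 : (0 < k)%N.

Notation kq := (k%:R : rat).

Definition aff_mul (x y : int * rat) : int * rat :=
  (x.1 + y.1, x.2 + kq ^ (- x.1) * y.2).
Definition aff_inv (x : int * rat) : int * rat := (- x.1, - (kq ^ x.1 * x.2)).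

Lemma aff_mulA : associative aff_mul.
Proof.
move=> [m x] [n y] [p z]; rewrite /aff_mul /= addrA opprD kexpD //.
by congr pair; ring.
Qed.

Lemma aff_mul0 x : aff_mul (0, 0) x = x.
Proof. by case: x => m x; rewrite /aff_mul /= oppr0 expr0z mul1r !add0r. Qed.

Lemma aff_mulr0 x : aff_mul x (0, 0) = x.
Proof. by case: x => m x; rewrite /aff_mul /= mulr0 !addr0. Qed.

Lemma aff_mulV x : aff_mul x (aff_inv x) = (0, 0).
Proof.
case: x => m x; rewrite /aff_mul /aff_inv /= subrr mulrN mulrA -kexpD //.
by rewrite addNr expr0z mul1r subrr.
Qed.

Lemma aff_Vmul x : aff_mul (aff_inv x) x = (0, 0).
Proof.
by case: x => m x; rewrite /aff_mul /aff_inv /= addNr opprK addNr.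
Qed.

Definition aff_letter (l : bs_gen * bool) : int * rat :=
  let x := if l.1 is gen_a then (0, 1) else (1, 0) in if l.2 then aff_inv x else x.

Definition aff_word (w : gword bs_gen) : int * rat :=
  foldr (fun l => aff_mul (aff_letter l)) (0, 0) w.

Lemma aff_word_cat u v : aff_word (u ++ v) = aff_mul (aff_word u) (aff_word v).
Proof.
by elim: u => [|l u IHu] /=; rewrite ?aff_mul0 // IHu aff_mulA.
Qed.

Lemma aff_word_pres u v : pres_eq (bs_rel k) u v -> aff_word u = aff_word v.
Proof.
elim=> // {u v} [u v w _ -> _ -> //|u u' v v' _ eq_u _ eq_v|[g b]|u v [-> ->]].
- by rewrite !aff_word_cat eq_u eq_v.
- rewrite /= aff_mulr0 /aff_letter /=; move: (if g is gen_a then _ else _) => x.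
  by case: b; [apply: aff_Vmul | apply: aff_mulV].
- have -> n : aff_word (nseq n (gen_a, false)) = (0, n%:R).
    elim: n => //= n ->; rewrite /aff_mul /aff_letter /= oppr0 expr0z mul1r.
    by rewrite -natr1 addr0 [1 + _]addrC.
  rewrite /= /aff_mul /aff_letter /aff_inv /=.
  by rewrite !(mulr0, addr0, oppr0, expr0z, mul1r, add0r, subrr, addNr,
    opprK) expr1z mulr1.
Qed.

Definition aff (x : BS k) : int * rat := aff_word (repr x).

Lemma aff_class u : aff (pres_class (bs_rel k) u) = aff_word u.
Proof. by apply: aff_word_pres; apply: pres_repr_class. Qed.

Lemma affM x y : aff (x * y)%g = aff_mul (aff x) (aff y).
Proof. by rewrite [(x * y)%g]/(pres_mul x y) aff_class aff_word_cat. Qed.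

Lemma aff1 : aff 1%g = (0, 0).
Proof. by rewrite [1%g]/(pres_one (bs_rel k)) aff_class. Qed.

Lemma affV x : aff (x^-1)%g = aff_inv (aff x).
Proof.
have : aff_mul (aff_inv (aff x)) (aff_mul (aff x) (aff x^-1)%g) = aff_inv (aff x).
  by rewrite -affM mulgV aff1 aff_mulr0.
by rewrite aff_mulA aff_Vmul aff_mul0.
Qed.

Lemma aff_a : aff (bs_elt k gen_a) = (0, 1).
Proof. by rewrite aff_class /= aff_mulr0. Qed.

Lemma aff_b : aff (bs_elt k gen_b) = (1, 0).
Proof. by rewrite aff_class /= aff_mulr0. Qed.

Lemma aff_aX n : aff (bs_elt k gen_a ^+ n)%g = (0, n%:R).
Proof.
elim: n => [|n IHn]; first by rewrite expg0 aff1.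
rewrite expgS affM IHn aff_a /aff_mul /= oppr0 expr0z mul1r addr0.
by rewrite -natr1 addrC.
Qed.

Lemma aff_bX n : aff (bs_elt k gen_b ^+ n)%g = (n%:Z, 0).
Proof.
elim: n => [|n IHn]; first by rewrite expg0 aff1.
by rewrite expgS affM IHn aff_b /aff_mul /= mulr0 addr0 -PoszD.
Qed.

(** * Normal forms and faithfulness of the affine representation *)

Section NormalForm.
Local Open Scope group_scope.
Notation a := (bs_elt k gen_a).
Notation b := (bs_elt k gen_b).

Definition bs_nf (p m n q : nat) : BS k := b ^+ p * (a ^+ m * a ^- n) * b ^- q.

Lemma conj_ab p : a ^ (b ^+ p) = a ^+ (k ^ p).
Proof.
elim: p => [|p IHp]; first by rewrite expg0 conjg1.
by rewrite expgS conjgM [a ^ b]bs_relE conjXg IHp -expgnA expnSr.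
Qed.

(** A letter a moves past b^p as a^(k^p). A letter b^-1 cancels against b^p or, for p = 0, moves
    past the power of a, multiplying its exponent by k, and joins b^(-q). *)
Lemma bs_nf_letter g e p m n q : exists p' m' n' q',
  (if e then (bs_elt k g)^-1 else bs_elt k g) * bs_nf p m n q = bs_nf p' m' n' q'.
Proof.
case: g e => [] []; rewrite /bs_nf.
- exists p, m, (n + k ^ p)%N, q; rewrite !mulgA [a^-1 * _]conjgC conjVg conj_ab.
  rewrite expgnDr invgM !mulgA -[b ^+ p * _ * _]mulgA.
  rewrite -[b ^+ p * a ^+ m / _]mulgA; congr (_ * _ * _ * _).
  by apply/esym/commuteV/commuteX2/commute_refl.
- exists p, (k ^ p + m)%N, n, q; rewrite !mulgA [a * _]conjgC conj_ab.
  by rewrite expgnDr !mulgA.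
- case: p => [|p].
    exists 0, (k * m)%N, (k * n)%N, q.+1; rewrite expg0 !mul1g.
    have conjE r : (a ^+ r) ^ b = a ^+ (k * r).
      by rewrite conjXg [a ^ b]bs_relE -expgnA.
    by rewrite -!conjE -conjVg -conjMg conjgE expgSr invgM !mulgA mulgK.
  by exists p, m, n, q; rewrite expgS !mulgA mulVg mul1g.
- by exists p.+1, m, n, q; rewrite expgS !mulgA.
Qed.

Lemma bs_nfP x : exists p m n q, x = bs_nf p m n q.
Proof.
rewrite -(pres_class_repr x); elim: (repr x) => [|[g e] w [p [m [n [q IHw]]]]].
  by exists 0, 0, 0, 0; rewrite /bs_nf !expg0 invg1 !mulg1.
have -> : pres_class (bs_rel k) ((g, e) :: w) =
    (if e then (bs_elt k g)^-1 else bs_elt k g) * pres_class (bs_rel k) w.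
  by case: e; rewrite ?[(bs_elt k g)^-1]pres_classV [_ * _]pres_classM.
by rewrite IHw; apply: bs_nf_letter.
Qed.
End NormalForm.

Lemma aff_nf p m n q : aff (bs_nf p m n q) = (p%:Z - q%:Z,
  kq ^ (- p%:Z) * (m%:R - n%:R)).
Proof.
rewrite /bs_nf !affM !affV !aff_bX !aff_aX /aff_mul /aff_inv /=.
by rewrite !(oppr0, expr0z, mul1r, mulr0, addr0, add0r).
Qed.

(** On a normal form, a trivial affine map forces p = q and m = n, so the word cancels. *)
Lemma aff_inj1 x : aff x = (0, 0) -> x = 1%g.
Proof.
have [p [m [n [q ->]]]] := bs_nfP x; rewrite aff_nf => -[/eqP pq /eqP].
rewrite mulf_eq0 (negbTE (kexp_neq0 k_gt0 _)) subr_eq0 eqr_nat => /eqP ->.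
by move: pq; rewrite subr_eq0 => /eqP[->]; rewrite /bs_nf mulgV mulg1 mulgV.
Qed.

Lemma aff_kfrac x : kfrac k (aff x).2.
Proof.
have [p [m [n [q ->]]]] := bs_nfP x; rewrite aff_nf; apply: kfracM => //.
  exact: kfrac_exp.
by apply: kfracB => //; apply: kfrac_nat.
Qed.

Lemma aff_onto (n : int) u : kfrac k u -> exists x, aff x = (n, u).
Proof.
case=> z [r ->]; have [m1 [m2 zE]] : exists m1 m2 : nat,
  z * k%:Z ^+ `|n| = m1%:Z - m2%:Z.
  by case: (z * _) => m; [exists m, 0%N; rewrite subr0 | exists 0%N, m.+1;
    rewrite NegzE sub0r].
(* Extending the fraction z / k^r by k^|n| gives p = r + |n|, which is at least n, so that q = p - n
   is a natural number. *)
exists (bs_nf (r + `|n|) m1 m2 `|(r + `|n|)%N%:Z - n|%N).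
rewrite aff_nf; congr pair; first by rewrite gez0_abs; lia.
have := congr1 (intmul (1 : rat)) zE; rewrite rmorphB rmorphM rmorphXn /= => <-.
rewrite -exprnN exprD invfM; have := kqX_neq0 k_gt0 r; have := kqX_neq0 k_gt0 `|n|.
by move: (kq ^+ r) (kq ^+ `|n|) => x y y_neq0 x_neq0; field; apply/andP.
Qed.

(** * Values of words in terms of [walk] and [apart] *)

Definition wlet (w : seq (nat * bool)) p := (nth (0%N, false) w p).1.
Definition wsgn (w : seq (nat * bool)) p := (nth (0%N, false) w p).2.

Lemma apart_ext L L' X X' s s' nu mu : L = L' -> (forall p,
  (p < L)%N -> X p = X' p) ->
  (forall p, (p < L)%N -> s p = s' p) ->
  walk X s nu L = walk X' s' nu L' /\ apart k L X s nu mu = apart k L' X' s' nu mu.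
Proof.
clear k_gt0; move=> <- {L'} eqX eqs;
  have eqW p : (p <= L)%N -> walk X s nu p = walk X' s' nu p.
  move=> le_pL; apply: eq_bigr => l _; have lt_lL := leq_trans (ltn_ord l) le_pL.
  by rewrite /sgp eqX // eqs.
split; first exact: eqW.
apply: eq_bigr => p _; rewrite /sgp /pos eqX // eqs // eqW //.
by case: (s' p); have := ltn_ord p; lia.
Qed.

Lemma apartS L X s nu mu : apart k L.+1 X s nu mu =
  apart k L X s nu mu + (sgp s L)%:~R * kq ^ (- pos X s nu L) * mu (X L).
Proof. by rewrite /apart big_ord_recr. Qed.

(** Induction on the last letter: a final factor only adds one term, whereas a new first letter
    would shift the exponents at all the others. *)
Lemma aff_weval (T : Type) (idx : T -> nat) (w : gword T) (s : T -> BS k)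
    (nu : nat -> int) (mu : nat -> rat) :
  (forall t, aff (s t) = (nu (idx t), mu (idx t))) ->
  let w' := [seq (idx l.1, l.2) | l <- w] in
  aff (weval s w) = (walk (wlet w') (wsgn w') nu (size w),
    apart k (size w) (wlet w') (wsgn w') nu mu).
Proof.
move=> sE /=; elim/last_ind: w => [|w l IHw].
  by rewrite /weval big_nil aff1 /walk /apart !big_ord0.
rewrite map_rcons; set w' := map _ w in IHw *.
have [] := @apart_ext (size w) (size w) (wlet (rcons w' (idx l.1, l.2))) (wlet w')
  (wsgn (rcons w' (idx l.1, l.2))) (wsgn w') nu mu erefl.
- by move=> p lt_p; rewrite /wlet nth_rcons size_map lt_p.
- by move=> p lt_p; rewrite /wsgn nth_rcons size_map lt_p.
move=> walkE apartE; rewrite size_rcons walkS apartS apartE /pos.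
have -> : weval s (rcons w l) = (weval s w * (if l.2 then (s l.1)^-1 else s l.1))%g.
  by rewrite /weval -cats1 big_cat big_seq1.
rewrite affM IHw /sgp /wsgn /wlet nth_rcons size_map ltnn eqxx /=.
have := walkS (wlet (rcons w' (idx l.1, l.2))) (wsgn (rcons w' (idx l.1,
  l.2))) nu (size w).
rewrite walkE /sgp /wsgn /wlet nth_rcons size_map ltnn eqxx /= -/(wlet _)
  -/(wsgn _).
rewrite /wlet /wsgn in walkE; case: l.2 walkE => /= walkE;
  rewrite ?addn1 ?addn0 => walkSE.
  rewrite walkSE affV sE /aff_mul /aff_inv /=; congr pair; first by rewrite mulN1r.
  by rewrite !mulN1r opprB addrC kexpD //; ring.
by rewrite sE walkE /aff_mul /= !mul1r.
Qed.
End BaumslagSolitar.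

Local Close Scope ring_scope.

(** * Deciding quadratic equations *)

(* Congruence modulo h turns k^(-e) into k^((h-1)e) and -1 into N-1, so that
   the value of a word is computed with natural numbers only. *)
Section Search.
Variable k : nat.

Definition wexp (h y W t : nat) : nat :=
  \sum_(0 <= l < t) h.-1 ^ odd (code_nth W l) * digit h y (code_nth W l)./2.

Definition wapart (h N y1 y2 W : nat) : nat :=
  \sum_(0 <= t < code_size W) N.-1 ^ odd (code_nth W t) *
    k ^ (h.-1 * wexp h y1 W (t + odd (code_nth W t))) * digit N y2 (code_nth W
      t)./2.

Definition check (h N W y1 y2 : nat) : bool :=
  ((digit h y1 0 == 0) && (digit h y1 1 == 1)) &&
  ((digit N y2 0 == 1) && (digit N y2 1 == 0)) &&
  ((h %| wexp h y1 W (code_size W)) && (N %| wapart h N y1 y2 W)).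

(** The code [c] of the equation also bounds the word length and the number of variables, so c + 2
    digits cover all letters. [y1] holds the exponents, [y2] the translation parts; entry 1 of the
    code is the word. *)
Definition decide_eq (c : nat) : bool :=
  has (fun y1 => has (fun y2 =>
      check (2 * radius c) (modulus k c) (code_nth c 1) y1 y2)
    (iota 0 (modulus k c ^ c.+2))) (iota 0 ((2 * radius c) ^ c.+2)).

Lemma crec_wexp n H Y W T : crec n H -> crec n Y -> crec n W -> crec n T ->
  crec n (fun v => wexp (H v) (Y v) (W v) (T v)).
Proof.
move=> recH recY recW recT; rewrite /wexp; crec; try apply: crec_digit; crec;
by apply: crec_code_nth; crec.
Qed.

Lemma crec_wapart n H N Y1 Y2 W : crec n H -> crec n N -> crec n Y1 -> crec n Y2 ->
  crec n W -> crec n (fun v => wapart (H v) (N v) (Y1 v) (Y2 v) (W v)).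
Proof.
move=> recH recN recY1 recY2 recW; rewrite /wapart.
have recL : crec n.+1 (fun u => code_nth (W (behead u)) (head 0 u)).
  by apply: crec_code_nth; crec.
apply: crec_sumb; first exact: crec_code_size.
apply: crec_mul; last by apply: crec_digit; crec.
apply: crec_mul; first by crec.
apply: crec_exp; first exact: crec_const.
by apply: crec_mul; [crec | apply: crec_wexp; crec].
Qed.

Lemma crec_check n H N W Y1 Y2 : crec n H -> crec n N -> crec n W -> crec n Y1 ->
  crec n Y2 -> crec n (fun v => check (H v) (N v) (W v) (Y1 v) (Y2 v)).
Proof.
move=> recH recN recW recY1 recY2; rewrite /check.
have recD B Y i : crec n B -> crec n Y -> crec n (fun v => digit (B v) (Y v) i).
  by move=> recB recY; apply: crec_digit => //; apply: crec_const.
apply: crec_and.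
  by apply: crec_and; apply: crec_and; apply: crec_eq;
    do ?[exact: recD | exact: crec_const].
apply: crec_and; apply: crec_dvd => //; last exact: crec_wapart.
by apply: crec_wexp => //; apply: crec_code_size.
Qed.

Lemma crec_radius n F : crec n F -> crec n (fun v => radius (F v)).
Proof. by move=> recF; rewrite /radius; crec. Qed.

Lemma crec_modulus n F : crec n F -> crec n (fun v => modulus k (F v)).
Proof.
move=> recF; rewrite /modulus; case: eqP => _.
  by apply: (@crec_ext _ _ (fun v => 2 * (F v).+1)) => [v _|];
    [rewrite mul2n | crec].
by crec; apply: crec_radius.
Qed.

Lemma crec_decide_eq : crec 1 (fun v => decide_eq (nth 0 v 0)).
Proof.
have recC n i : i < n -> crec n (fun v => nth 0 v i) by apply: crec_var.
rewrite /decide_eq; apply: (@crec_has 1 _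
  (fun y1 v => has (fun y2 => check (2 * radius (nth 0 v 0)) (modulus k (nth 0 v 0))
    (code_nth (nth 0 v 0) 1) y1 y2) (iota 0 (modulus k (nth 0 v 0) ^ (nth 0 v
      0).+2)))).
  apply: crec_exp; last by do 2!apply: crec_S; apply: recC.
  by apply: crec_mul; [apply: crec_const | apply: crec_radius; apply: recC].
apply: (@crec_has 2 _
  (fun y2 u => check (2 * radius (nth 0 (behead u) 0)) (modulus k (nth 0 (behead
    u) 0))
    (code_nth (nth 0 (behead u) 0) 1) (head 0 u) y2)).
  have rec0 : crec 2 (fun u => nth 0 (behead u) 0) by apply: (@crec_weak 1 (nth
    0 ^~ 0)); apply: recC.
  by apply: crec_exp; [apply: crec_modulus | do 2!apply: crec_S].
have rec0 : crec 3 (fun u => nth 0 (behead (behead u)) 0).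
  by apply: (@crec_weak2 1 (nth 0 ^~ 0)); apply: recC.
apply: crec_check.
- by apply: crec_mul; [apply: crec_const | apply: crec_radius].
- exact: crec_modulus.
- by apply: crec_code_nth; [|apply: crec_const].
- by apply: (@crec_weak 2 (head 0)); apply: crec_head.
- exact: crec_head.
Qed.
End Search.

Local Open Scope ring_scope.

(** * Correctness of the finite search *)

Section Soundness.
Variable k : nat.
Hypothesis k_gt0 : (0 < k)%N.
Notation kq := (k%:R : rat).

Lemma kidealM_congr d u u' v v' : kideal k d (u - u') -> kideal k d (v - v') ->
  kfrac k v -> kfrac k u' -> kideal k d (u * v - u' * v').
Proof.
move=> uu' vv' vP u'P; have -> : u * v - u' * v' = (u - u') * v + u' * (v - v')
  by ring.
by apply: kidealD => //; [apply: kidealMr | apply: kidealMl].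
Qed.

(** In the Bezout relation x N + y k^p = 1 the number y inverts k^p modulo N, so the residue of z y
    represents z / k^p. *)
Lemma kfrac_residue N u : (0 < N)%N -> coprime N k -> kfrac k u ->
  exists2 r : nat, (r < N)%N & kideal k N%:R (r%:R - u).
Proof.
move=> N_gt0 copNk [z [p ->]].
have [[x y] /= xyE] : exists xy : int * int, xy.1 * N%:Z + xy.2 * k%:Z ^+ p = 1.
  have /coprimezP[[x y] /= xyE] : coprimez N%:Z (k%:Z ^+ p).
    by rewrite coprimezXr // coprimezE.
  by exists (x, y).
have rP := modz_ge0 (z * y) (_ : N%:Z != 0).
have r_lt := ltz_pmod (z * y) (_ : 0 < N%:Z).
exists `|((z * y) %% N)%Z|%N; first by have := rP; have := r_lt; lia.
have rE : `|((z * y) %% N)%Z|%N%:Z = z * y - (z * y %/ N)%Z * N%:Z.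
  by rewrite gez0_abs ?rP; move: (divz_eq (z * y) N); lia.
exists (- (z * x)%:~R / kq ^+ p - (z * y %/ N)%Z%:~R).
  apply: kfracB => //; last exact: kfrac_int.
  by exists (- (z * x)), p; rewrite rmorphN.
have -> : (`|((z * y) %% N)%Z|%N)%:R = (z * y - (z * y %/ N)%Z * N%:Z)%:~R :> rat.
  by rewrite -rE.
have := congr1 (intmul (1 : rat)) xyE.
rewrite !(rmorphB, rmorphD, rmorphM, rmorphXn) /= => {}xyE.
have kp := kqX_neq0 k_gt0 p.
have -> : z%:~R / kq ^+ p = z%:~R * (x%:~R * N%:R + y%:~R * kq ^+ p) / kq ^+ p.
  by rewrite xyE mulr1.
by rewrite -!pmulrn; field.
Qed.

Variables (c W : nat).
Notation g := (radius c).
Notation h := (2 * g)%N.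
Notation N := (modulus k c).
Notation X := (fun p => (code_nth W p)./2).
Notation s := (fun p => odd (code_nth W p)).
Notation L := (code_size W).

Lemma radius_gt1 : (1 < g)%N.
Proof. by apply: leq_trans (_ : 2`! <= _)%N; rewrite // leq_fact. Qed.

Lemma modulus_gt1 : (1 < N)%N.
Proof.
rewrite /modulus; case: eqP => [_|k1]; first by rewrite doubleS.
have : (2 ^ 2 <= k ^ g)%N.
  apply: (@leq_trans (k ^ 2)); first by rewrite leq_exp2r; lia.
  by rewrite leq_exp2l ?radius_gt1; lia.
by case: (k ^ g)%N => [|[|[|m]]].
Qed.

Lemma modulus_coprime : coprime N k.
Proof.
rewrite /modulus; case: eqP => [->|_]; first by rewrite coprimen1.
by rewrite coprime_predX // ltnW // radius_gt1.
Qed.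

Lemma modulus_exp (m n : int) : (g%:Z %| m - n)%Z -> kideal k N%:R (kq ^ m - kq
  ^ n).
Proof.
move=> dvd_mn; have [k1|k1] := eqVneq k 1%N.
  have -> : kq ^ m - kq ^ n = 0 by rewrite k1 !exp1rz subrr.
  exact: kideal0.
rewrite /modulus (negbTE k1) predX_rat //.
exact: kideal_subX_congr.
Qed.

Section Congruence.
Variables (y1 y2 : nat) (nu : nat -> int) (mu : nat -> rat).
Hypothesis nuP : forall p, (p < L)%N -> (h%:Z %| (digit h y1 (X p))%:Z - nu (X
  p))%Z.
Hypothesis muP : forall p, (p < L)%N -> kideal k N%:R ((digit N y2 (X p))%:R -
  mu (X p)).

Lemma wexp_congr t : (t <= L)%N -> (h%:Z %| (wexp h y1 W t)%:Z - walk X s nu t)%Z.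
Proof.
have h_gt0 : (0 < h)%N by have := radius_gt1; lia.
elim: t => [|t IHt] lt_tL; first by rewrite /wexp /walk big_geq // big_ord0.
rewrite /wexp big_nat_recr //= -/(wexp _ _ _ _) walkS.
have := rpredD (IHt (ltnW lt_tL)) (_ : (h%:Z %| (h.-1 ^ odd (code_nth W t) *
  digit h y1 (X t))%N%:Z - sgp s t * nu (X t))%Z).
rewrite PoszD opprD addrACA; apply; rewrite /sgp.
have := nuP lt_tL; case: (odd _) => dvd_t; last by rewrite mul1n mul1r.
rewrite expn1 mulN1r opprK PoszM -subn1 -subzn // mulrBl mul1r.
have := rpredB (dvdz_mulr (digit h y1 (X t))%:Z (dvdzz h%:Z)) dvd_t.
by congr (_ %| _)%Z; ring.
Qed.

Lemma wapart_congr :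
  kideal k N%:R ((wapart k h N y1 y2 W)%:R - apart k L X s nu mu).
Proof.
rewrite /wapart big_mkord natr_sum /apart -sumrB; apply: kideal_sum => // p _.
have lt_pL := ltn_ord p; rewrite !natrM.
have sgnP : kideal k N%:R ((N.-1 ^ s p)%:R - (sgp s p)%:~R).
  rewrite /sgp; case: (odd _); last by rewrite subrr; apply: kideal0.
  exists 1; first exact: kfrac1.
  rewrite expn1 -subn1 natrB ?(ltnW modulus_gt1) // mulr1 opprK.
  by rewrite subrK.
have expP : kideal k N%:R ((k ^ (h.-1 * wexp h y1 W (p + s p)))%:R - kq ^ (- pos
  X s nu p)).
  rewrite natrX exprnP; apply: modulus_exp.
  have le_p : (p + s p <= L)%N by case: (odd _); lia.
  have := wexp_congr le_p; rewrite /pos; move: (wexp _ _ _ _) (walk _ _ _ _) => e v.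
  have h_gt0 : (0 < h)%N by have := radius_gt1; lia.
  (* The exponents are known modulo h = 2g; powers of k only need them modulo g, where (h - 1) e is
     -e. *)
  move=> /(dvdz_trans (dvdz_mull 2 (dvdzz g%:Z))).
  move/(rpredB (dvdz_mulr (2 * e%:Z) (dvdzz g%:Z))).
  by congr (_ %| _)%Z; rewrite PoszM -subn1 -subzn // PoszM; ring.
have kf (m : nat) : kfrac k m%:R by apply: kfrac_nat.
apply: kidealM_congr (muP lt_pL) _ _ => //; last first.
  by apply: kfracM => //; [apply: kfrac_int | apply: kfrac_exp].
by apply: kidealM_congr => //; apply: kfrac_int.
Qed.
End Congruence.

(** Digits passing the test are themselves integral exponents and translation parts, to which
    [solve_mod] applies. Conversely, a true solution is reduced modulo h and [N]. *)
Lemma checkP m : quadr L X -> (L <= c)%N -> (forall p, (p < L)%N -> (X p < m)%N) ->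
  (m <= c.+2)%N -> (1 < m)%N ->
  (exists y1 y2, [/\ (y1 < h ^ c.+2)%N, (y2 < N ^ c.+2)%N & check k h N W y1 y2])
  <-> solved k L X s.
Proof.
move=> quad le_Lc X_lt le_mc m_gt1.
have h_gt1 : (1 < h)%N by have := radius_gt1; lia.
have N_gt1 := modulus_gt1.
split=> [[y1 [y2 [_ _]]]|[nu [mu [[nu0 nu1 mu0 mu1 muP] walk0 apart0]]]].
  move=> /andP[/andP[/andP[/eqP d0 /eqP d1] /andP[/eqP e0 /eqP e1]] /andP[h_dvd
    N_dvd]].
  pose nu z := (digit h y1 z)%:Z; pose mu z : rat := (digit N y2 z)%:R.
  have nuP p : (p < L)%N -> (h%:Z %| (digit h y1 (X p))%:Z - nu (X p))%Z.
    by move=> _; rewrite subrr dvdz0.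
  have muP p : (p < L)%N -> kideal k N%:R ((digit N y2 (X p))%:R - mu (X p)).
    by move=> _; rewrite subrr; apply: kideal0.
  apply: (solve_mod k_gt0 quad le_Lc (nu := nu) (mu := mu)).
  - by split; rewrite /nu /mu ?d0 ?d1 ?e0 ?e1 // => z; apply: kfrac_nat.
  - have h_dvdz : (h%:Z %| (wexp h y1 W L)%:Z)%Z by rewrite dvdzE.
    by have := rpredB h_dvdz (wexp_congr nuP (leqnn L));
      rewrite opprB addrC subrK PoszM.
  - have [q qE] := dvdnP N_dvd.
    have := wapart_congr nuP muP; rewrite qE natrM => /kidealN.
    rewrite opprB => /(kideal_congr k_gt0); apply; apply: kidealMl => //;
      last exact: kideal_id.
    exact: kfrac_nat.
pose f1 z := `|(nu z %% h)%Z|%N.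
have f1P z : (f1 z)%:Z = (nu z %% h)%Z by rewrite /f1 gez0_abs // modz_ge0 //; lia.
have f1_lt z : (f1 z < h)%N by rewrite -ltz_nat f1P ltz_pmod //; lia.
(* The residues at the letters a and b are fixed to be 1 and 0, as [check] compares these digits
   literally. *)
have /choice[f2 f2P] : forall z, exists r : nat, [/\ (r < N)%N,
  kideal k N%:R (r%:R - mu z),
    z = 0%N -> r = 1%N & z = 1%N -> r = 0%N].
  move=> z; have [->|z0] := eqVneq z 0%N.
    by exists 1%N; rewrite mu0 subrr; split=> //; apply: kideal0.
  have [->|z1] := eqVneq z 1%N.
    by exists 0%N; rewrite mu1 subrr; split=> //; [lia | apply: kideal0].
  have [r r_lt rP] := kfrac_residue (ltnW N_gt1) modulus_coprime (muP z).
  by exists r; split=> // zE; [rewrite zE in z0 | rewrite zE in z1].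
have [y1 y1_lt y1P] := @digit_ex h c.+2 f1 (fun z _ => f1_lt z).
have [y2 y2_lt y2P] := @digit_ex N c.+2 f2 (fun z _ =>
  let: And4 r_lt _ _ _ := f2P z in r_lt).
exists y1, y2; split=> //; rewrite /check !y1P // !y2P //.
have nuP p : (p < L)%N -> (h%:Z %| (digit h y1 (X p))%:Z - nu (X p))%Z.
  move=> lt_pL; rewrite y1P ?(leq_trans (X_lt p lt_pL)) // f1P.
  rewrite [X in _ - X](divz_eq _ h%:Z) opprD addrCA subrr addr0 rpredN.
  by apply: dvdz_mull.
have muP' p : (p < L)%N -> kideal k N%:R ((digit N y2 (X p))%:R - mu (X p)).
  move=> lt_pL; rewrite y2P ?(leq_trans (X_lt p lt_pL)) //.
  by have [] := f2P (X p).
have f1_0 : f1 0%N = 0%N by rewrite /f1 nu0 mod0z.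
have f1_1 : f1 1%N = 1%N by rewrite /f1 nu1 modz_small //; lia.
have [_ _ -> // _] := f2P 0%N; have [_ _ _ -> //] := f2P 1%N.
rewrite f1_0 f1_1 /=; apply/andP; split.
  by have := wexp_congr nuP (leqnn L); rewrite walk0 subr0 dvdzE.
have := wapart_congr nuP muP'; rewrite apart0 subr0 => wapartN.
by have := @kideal_natP k k_gt0 N (wapart k h N y1 y2 W)%:Z modulus_coprime wapartN;
  rewrite dvdzE.
Qed.
End Soundness.

Local Close Scope ring_scope.

(** * From equations and their Goedel numbers to letters at positions *)

Lemma count2_nth (T : Type) (x0 : T) (P : pred T) (w : seq T) : count P w = 2 ->
  exists i j, [/\ i < j < size w, P (nth x0 w i), P (nth x0 w j) &
    forall p, p < size w -> P (nth x0 w p) -> p = i \/ p = j].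
Proof.
move=> count2; pose A := [set p : 'I_(size w) | P (nth x0 w p)].
have cardA : #|A| == 2.
  by rewrite cardsE -sum1_card -count2 -sum1_count (big_nth x0) big_mkord.
have [i [j [ij AE]]] := elimT (cards2P A) cardA.
have inA p : P (nth x0 w (nat_of_ord p)) = (p == i) || (p == j).
  by have := in_set2 p i j; rewrite -AE inE.
have only p : p < size w -> P (nth x0 w p) -> p = i \/ p = j.
  by move=> lt_p; have := inA (Ordinal lt_p) => /= -> /orP[] /eqP <-;
    [left | right].
have [Pi Pj] : P (nth x0 w i) /\ P (nth x0 w j) by rewrite !inA !eqxx orbT.
case: (ltngtP i j) => [lt_ij|lt_ji|/val_inj eq_ij];
  last by rewrite eq_ij eqxx in ij.
  by exists i, j; rewrite lt_ij ltn_ord.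
exists j, i; rewrite lt_ji ltn_ord; split=> // p lt_p /(only p lt_p).
by case; auto.
Qed.

Section Letters.
Variables (T : Type) (idx : T -> nat) (w : gword T).

Lemma code_nth_word t :
  ((code_nth (word_code idx w) t)./2 = wlet [seq (idx l.1, l.2) | l <- w] t) /\
  (odd (code_nth (word_code idx w) t) = wsgn [seq (idx l.1, l.2) | l <- w] t).
Proof.
rewrite /word_code code_nthE /wlet /wsgn; elim: w t => [|l v IHv] [|t] //=.
by rewrite addnC half_bit_double oddD odd_double addbF oddb.
Qed.

Lemma code_size_word : code_size (word_code idx w) = size w.
Proof. by rewrite code_sizeE size_map. Qed.

Lemma size_le_word_code : size w <= word_code idx w.
Proof. by apply: leq_trans (code_gt_size _); rewrite size_map. Qed.
End Letters.

Section Equations.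
Variable k : nat.
Hypothesis k_gt0 : 0 < k.
Variable E : equation.
Notation n := (eq_nvars E).
Notation W := (word_code (@letter_index n) (eq_word E)).
Notation X := (fun p => (code_nth W p)./2).
Notation s := (fun p => odd (code_nth W p)).
Notation L := (code_size W).
Notation raw := [seq (letter_index l.1, l.2) | l <- eq_word E].

Lemma solvable_solved : solvable_in_BS k E <-> solved k L X s.
Proof.
have transfer nu mu :
    walk (wlet raw) (wsgn raw) nu (size (eq_word E)) = walk X s nu L /\
    apart k (size (eq_word E)) (wlet raw) (wsgn raw) nu mu = apart k L X s nu mu.
  apply: apart_ext; first by rewrite code_size_word.
    by move=> p _; have [-> _] := code_nth_word (@letter_index n) (eq_word E) p.
  by move=> p _; have [_ ->] := code_nth_word (@letter_index n) (eq_word E) p.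
split=> [[sol solP]|[nu [mu [[nu0 nu1 mu0 mu1 muP] walk0 apart0]]]].
  (* Indices 0 and 1 carry a and b; indices that belong to no variable get the neutral pair. *)
  pose val z : int * rat := if z is z'.+2 then
      (if insub z' is Some x then aff (sol x) else (0, 0))%R
    else if z is 1 then (1, 0)%R else (0, 1)%R.
  have valP t : aff (match t with inl x => sol x | inr g => bs_elt k g end) =
      ((val (@letter_index n t)).1, (val (letter_index t)).2).
    rewrite -surjective_pairing; case: t => [x|[]] /=; rewrite ?aff_a ?aff_b //.
    by rewrite valK.
  have := aff_weval k_gt0 (nu := fst \o val) (mu := snd \o val) (eq_word E) valP.
  have := solP; rewrite /is_solution => ->; rewrite (aff1 k_gt0).
  have [-> ->] := transfer (fst \o val) (snd \o val) => -[walk0 apart0].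
  exists (fst \o val), (snd \o val); split=> //; split=> //= z.
  case: z => [|[|z]] /=; first exact: kfrac1; first exact: kfrac0.
  by case: insubP => [x _ _|_]; [apply: (aff_kfrac k_gt0) | apply: kfrac0].
have /choice[sol solP] : forall x : 'I_n, exists y : BS k,
    aff y = (nu x.+2, mu x.+2) by move=> x; apply: aff_onto.
exists sol; rewrite /is_solution; apply: (aff_inj1 k_gt0).
have valP t : aff (match t with inl x => sol x | inr g => bs_elt k g end) =
    (nu (@letter_index n t), mu (letter_index t)).
  by case: t => [x|[]] /=; rewrite ?solP ?aff_a ?aff_b ?nu0 ?nu1 ?mu0 ?mu1.
rewrite (aff_weval k_gt0 (eq_word E) valP).
by have [-> ->] := transfer nu mu; rewrite walk0 apart0.
Qed.

Lemma letter_lt p : X p < n.+2.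
Proof.
have [-> _] := code_nth_word (@letter_index n) (eq_word E) p.
rewrite /wlet; elim: (eq_word E) p => [|[t b] v IHv] [|p] //=.
by case: t => [x|[]] //=; rewrite !ltnS.
Qed.

Lemma quadratic_quadr : quadratic E -> quadr L X.
Proof.
move=> quadE p; rewrite code_size_word => lt_p.
have XE q : X q = wlet raw q by have [] := code_nth_word (@letter_index n)
  (eq_word E) q.
rewrite XE /wlet => Xp_gt1; set z := (nth _ raw p).1 in Xp_gt1 *.
have countE : occurrences z [seq (letter_index l.1, l.2) | l <- eq_word E] = 2.
  have raw_p : (z, (nth (0, false) raw p).2) \in raw.
    by rewrite -surjective_pairing mem_nth // size_map.
  have /mapP[[[x|[]] b] l_in [zE _]] := raw_p; rewrite ?zE // in Xp_gt1 *.
  rewrite /occurrences count_map; rewrite -(quadE x).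
    by apply: eq_count => -[[y|[]] c] //=; rewrite eqSS eqSS.
  by rewrite -has_count; apply/hasP; exists (inl x, b).
have [i [j [ijP /eqP Xi /eqP Xj only]]] := count2_nth (0, false) countE.
exists i, j; rewrite !XE size_map in ijP *; split; last by rewrite /wlet Xi.
split=> //; first by rewrite !XE /wlet Xi Xj.
move=> q lt_q; rewrite !XE /wlet Xi => /eqP.
by apply: only; rewrite size_map.
Qed.

Lemma decide_eqP : quadratic E ->
  decide_eq k (equation_code E) <-> solvable_in_BS k E.
Proof.
move=> quadE; rewrite solvable_solved /equation_code.
set c := CodeSeq.code _.
have cE : code_nth c 1 = W by rewrite /c code_nthE.
have le_nc : n <= c by have := code_gt_nth [:: n; W] 0.
have le_Lc : L <= c.
  apply: leq_trans (_ : W <= c); last by have := code_gt_nth [:: n; W] 1.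
  by rewrite code_size_word size_le_word_code.
rewrite -(checkP k_gt0 (quadratic_quadr quadE) le_Lc (fun p _ => letter_lt p)) //.
rewrite /decide_eq cE; split=> [/hasP[y1]|[y1 [y2 [y1_lt y2_lt ok]]]].
  rewrite mem_iota => y1_lt /hasP[y2]; rewrite mem_iota => y2_lt ok.
  by exists y1, y2.
apply/hasP; exists y1; first by rewrite mem_iota.
by apply/hasP; exists y2; rewrite // mem_iota.
Qed.
End Equations.

Lemma decidable_equations k : 0 < k ->
  algorithmically_decidable equation_code quadratic (solvable_in_BS k).
Proof.
move=> k_gt0; exists (fun v => decide_eq k (nth 0 v 0));
  first exact: crec_decide_eq.
move=> E quadE /=; have [decP Pdec] := decide_eqP k_gt0 quadE.
by split=> [/Pdec->//|nP]; case: (decide_eq _ _) decP => // /(_ isT).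
Qed.

Local Open Scope ring_scope.

(** * Deciding coefficient-free systems *)

Section LinearForms.
Variable n : nat.
Implicit Types (w : gword 'I_n).

(** The value of the abelianized word; the exponent sums [expo] are the entries of the matrix of the
    abelianized system. *)
Definition lform (V : zmodType) (f : 'I_n -> V) w : V :=
  \sum_(l <- w) (if l.2 then - f l.1 else f l.1).

Definition expo w x : int :=
  \sum_(l <- w) (if l.1 == x then (if l.2 then -1 else 1) else 0).

Lemma lformE (R : comPzRingType) (f : 'I_n -> R) w :
  lform f w = \sum_x (expo w x)%:~R * f x.
Proof.
rewrite /lform /expo.
under [RHS]eq_bigr => x _ do rewrite (rmorph_sum (intmul (1 : R))) mulr_suml.
rewrite exchange_big; apply: eq_bigr => l _ /=.
rewrite (bigD1 l.1) //= eqxx big1 ?addr0 => [|x]; last first.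
  by rewrite eq_sym => /negbTE->; rewrite mul0r.
by case: l.2; rewrite ?mulN1r ?mul1r.
Qed.

Lemma expo_le w x : `|expo w x| <= (size w)%:Z.
Proof.
rewrite /expo; elim: w => [|l w IHw]; first by rewrite big_nil normr0.
rewrite big_cons /=; have := ler_normD (if l.1 == x then if l.2 then -1 else 1
  else 0 : int)
  (\sum_(l0 <- w) (if l0.1 == x then if l0.2 then -1 else 1 else 0)).
move: (\sum_(l0 <- w) _) IHw => S IHw; case: (l.1 == x); case: l.2; lia.
Qed.

Lemma clear_denominators (f : 'I_n -> rat) : exists2 D : int, D != 0 &
  exists v : 'I_n -> int, forall x, (v x)%:~R = D%:~R * f x.
Proof.
exists (\prod_x denq (f x)); first by apply/prodf_neq0 => x _; apply: denq_neq0.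
exists (fun x => numq (f x) * \prod_(y | y != x) denq (f y)) => x.
rewrite [X in _ = X%:~R * _](bigD1 x) //= !rmorphM /= -[X in _ = _ * X]divq_num_den.
by have : (denq (f x))%:~R != 0 :> rat by [rewrite intr_eq0 denq_neq0];
  move=> *; field.
Qed.

Variable ws : seq (gword 'I_n).

Definition has_kernel (R : comPzRingType) : Prop :=
  exists v : 'I_n -> R, (forall w, w \in ws -> lform v w = 0) /\ exists x, v x != 0.

Lemma has_kernel_rat : has_kernel rat -> has_kernel int.
Proof.
move=> [f [f_ker [x fx]]]; have [D D_neq0 [v vE]] := clear_denominators f.
exists v; split; last first.
  by exists x; rewrite -(intr_eq0 rat) vE mulf_neq0 ?intr_eq0.
move=> w /f_ker; rewrite !lformE => fw; apply: (@intr_inj rat).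
rewrite rmorph_sum /= -[RHS](mulr0 D%:~R) -[X in _ = _ * X]fw mulr_sumr;
  apply: eq_bigr => y _.
by rewrite rmorphM /= vE intz; ring.
Qed.

(** A kernel vector with only even entries can be halved, which lowers the sum of the absolute
    values. *)
Lemma has_kernel_odd : has_kernel int -> exists v : 'I_n -> int,
  (forall w, w \in ws -> lform v w = 0) /\ exists x, ~~ (2 %| v x)%Z.
Proof.
move=> [v]; have [m le_m] := ubnP (\sum_x `|v x|)%N.
elim: m v le_m => // m IHm v le_m [v_ker [x vx]].
have [v_even|] := pselect (forall x, (2 %| v x)%Z); last first.
  move=> not_even; exists v; split=> //; apply: contrapT => no_odd.
  by apply: not_even => y; apply: contrapT => /negP odd_y; apply: no_odd; exists y.
pose u y := (v y %/ 2)%Z; have vE y : v y = u y * 2 by rewrite /u divzK.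
apply: (IHm u).
  rewrite -ltnS; apply: leq_trans le_m;
    rewrite ltnS (bigD1 x) //= [X in (_ < X)%N](bigD1 x) //=.
  have le_u y : (`|u y| <= `|v y|)%N by rewrite vE abszM leq_pmulr.
  rewrite -addSn leq_add //; last exact: leq_sum.
  by move: vx; rewrite vE; lia.
split; last by exists x; move: vx; rewrite vE; lia.
move=> w /v_ker; rewrite !lformE => vw; apply: (@mulIf _ (2 : int)) => //.
rewrite mul0r -[RHS]vw mulr_suml; apply: eq_bigr => y _.
by rewrite [in RHS]vE mulrA.
Qed.

Variable c : nat.
Hypotheses (c_gt0 : (0 < c)%N) (le_nc : (n <= c)%N).
Hypothesis size_le : forall w, w \in ws -> (size w <= c)%N.

(** Bounds n! c^n for n <= c, that is, the Leibniz expansion of an n by n minor with entries of size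
    at most c. *)
Definition minor_bound : nat := c ^ c * c ^ c.
Definition kernel_modulus : nat := 2 * minor_bound`!.

Lemma det_bound (A : 'M[int]_n) : (forall i j, `|A i j| <= c%:Z) ->
  `|\det A| <= minor_bound%:Z.
Proof.
move=> A_le; apply: le_trans (ler_norm_sum _ _ _) _.
have prod_le (f : 'I_n -> 'I_n) : `|\prod_i A i (f i)| <= (c ^ n)%N%:Z.
  rewrite normr_prod; apply: le_trans (_ : \prod_(i < n) c%:Z <= _).
    by apply: ler_prod => i _; rewrite normr_ge0 A_le.
  by rewrite prodr_const card_ord exp_Posz.
apply: le_trans (ler_sum _ (_ : forall s, _ -> _ <= (c ^ n)%N%:Z)) _ => [s _|].
  by rewrite normrM normrX normrN1 expr1n mul1r.
rewrite sumr_const perm.card_Sn -mulr_natr natz -PoszM lez_nat /minor_bound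
  leq_mul //.
  by rewrite leq_pexp2l.
apply: leq_trans (_ : n ^ n <= _)%N; last first.
  apply: leq_trans (leq_pexp2l c_gt0 le_nc); have [->|n_gt0] := posnP n;
    first by rewrite !expn0.
  by rewrite leq_exp2r.
rewrite fact_prod; apply: leq_trans (_ : \prod_(1 <= i < n.+1) n <= _)%N.
  rewrite !big_seq; apply: leq_prod => i; by rewrite mem_index_iota; lia.
by rewrite prod_nat_const_nat subSS subn0.
Qed.

(* If the forms have full rank, a nonzero maximal minor D divides
   minor_bound`!, and D annihilates the kernel modulo kernel_modulus, so that
   all the entries of a kernel vector are even. *)
Lemma kernel_mod : has_kernel int <-> exists d : 'I_n -> nat,
  [/\ forall x, (d x < kernel_modulus)%N,
      forall w, w \in ws -> (kernel_modulus%:Z %| lform (fun x => (d x)%:Z) w)%Z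
    & exists x, odd (d x)].
Proof.
have N_gt0 : (0 < kernel_modulus)%N by rewrite muln_gt0 fact_gt0.
split=> [/has_kernel_odd[v [v_ker [x x_odd]]]|[d [d_lt d_ker [x x_odd]]]].
  pose d y := `|(v y %% kernel_modulus)%Z|%N.
  have dE y : (d y)%:Z = v y - (v y %/ kernel_modulus)%Z * kernel_modulus%:Z.
    by rewrite /d gez0_abs ?modz_ge0 //; move: (divz_eq (v y) kernel_modulus); lia.
  exists d; split=> [y|w w_in|].
  - by rewrite -ltz_nat /d gez0_abs ?modz_ge0 ?ltz_pmod //; lia.
  - rewrite lformE; under eq_bigr => y _ do rewrite dE mulrBr mulrA.
    rewrite sumrB -lformE v_ker // sub0r rpredN -mulr_suml.
    exact: dvdz_mull.
  exists x; apply: contraNT x_odd => x_even.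
  have -> : v x = (d x)%:Z + (v x %/ kernel_modulus)%Z * kernel_modulus%:Z by
    rewrite dE; ring.
  rewrite rpredD //; first by rewrite dvdzE dvdn2.
  by apply: dvdz_mull; rewrite dvdzE dvdn_mulr.
apply: has_kernel_rat.
pose m := size ws; pose M : 'M[int]_(m, n) := \matrix_(j, y) expo (nth [::] ws j) y.
pose A : 'M[rat]_(m, n) := map_mx intr M.
(* A rank defect yields a nonzero rational kernel vector at once; full rank will contradict the odd
   entry of [d]. *)
have [A_full|A_nfull] := boolP (row_full A); last first.
  have : ~~ row_free A^T by rewrite /row_free mxrank_tr.
  rewrite -kermx_eq0 => /rowV0Pn[u /sub_kermxP uA /rV0Pn[y uy]].
  exists (u 0); split; last by exists y.
  move=> w /(nthP [::])[j lt_j <-]; have /rowP/(_ (Ordinal lt_j)) := uA.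
  rewrite !mxE lformE => uA0; rewrite -[RHS]uA0; apply: eq_bigr => z _.
  by rewrite !mxE mulrC.
pose S := rowsub (fullrankfun A_full) M.
have detS : \det S != 0.
  rewrite -(intr_eq0 rat) -(det_map_mx intr) /S map_mxsub.
  by rewrite -unitfE -unitmxE -row_full_unit fullrowsub_full.
have S_le i j : `|S i j| <= c%:Z.
  rewrite !mxE; apply: le_trans (expo_le _ _) _.
  by rewrite lez_nat size_le // mem_nth.
have detS_dvd : (`|\det S|%N %| minor_bound`!)%N.
  rewrite dvdn_fact // absz_gt0 detS /=; have := det_bound S_le; lia.
have det_d : (kernel_modulus%:Z %| \det S * (d x)%:Z)%Z.
  (* Multiplying S d, whose entries the modulus divides, by the adjugate of S gives det S times
     d. *)
  have := mul_adj_mx S => /(congr1 (mulmx^~ (\col_y (d y)%:Z))).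
  rewrite -mulmxA mul_scalar_mx => /colP/(_ x); rewrite !mxE => <-.
  apply: rpred_sum => i _; apply: dvdz_mull.
  rewrite !mxE; have := d_ker (nth [::] ws (fullrankfun A_full i)) (mem_nth _
    (ltn_ord _)).
  by rewrite lformE; congr (_ %| _)%Z; apply: eq_bigr => y _; rewrite !mxE intz.
have [e eE] := dvdnP detS_dvd.
have : (kernel_modulus%:Z %| (minor_bound`! * d x)%N%:Z)%Z.
  rewrite eE dvdzE /= -mulnA dvdn_mull //.
  by move: det_d; rewrite dvdzE abszM.
(* Cancelling [minor_bound]! leaves 2 | d x, which is false. *)
by rewrite dvdzE /= /kernel_modulus mulnC dvdn_pmul2l ?fact_gt0 // dvdn2 x_odd.
Qed.
End LinearForms.

Local Close Scope ring_scope.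

(** * Non-trivial solutions and kernel vectors of the exponent sums *)

Section Systems.
Variable k : nat.
Hypothesis k_gt0 : 0 < k.
Local Open Scope ring_scope.

Section Evaluation.
Variables (n : nat) (sol : 'I_n -> BS k).

Lemma aff_weval_fst w : (aff (weval sol w)).1 = lform (fun x => (aff (sol x)).1) w.
Proof.
elim: w => [|l w IHw]; first by rewrite /weval /lform !big_nil aff1.
rewrite /weval /lform !big_cons affM // -/(weval _ _) /= IHw; congr (_ + _).
by case: l.2; rewrite ?affV.
Qed.

(** When all exponents are 0 the group law is the addition of translations. *)
Lemma aff_weval_snd w : (forall x, (aff (sol x)).1 = 0) ->
  (aff (weval sol w)).2 = lform (fun x => (aff (sol x)).2) w.
Proof.
move=> sol1; elim: w => [|l w IHw]; first by rewrite /weval /lform !big_nil aff1.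
rewrite /weval /lform !big_cons affM // -/(weval _ _) /= IHw.
by case: l.2; rewrite ?affV //= sol1 ?oppr0 expr0z !mul1r.
Qed.

Lemma aff_weval_snd0 w : (forall x,
  (aff (sol x)).2 = 0) -> (aff (weval sol w)).2 = 0.
Proof.
move=> sol2; elim: w => [|l w IHw]; first by rewrite /weval big_nil aff1.
rewrite /weval big_cons affM // -/(weval _ _) /= IHw mulr0 addr0.
by case: l.2; rewrite ?affV //= sol2 ?mulr0 ?oppr0.
Qed.
End Evaluation.

(** A non-trivial solution has a nonzero exponent of b somewhere, or else consists of translations
    that are not all 0; either gives a kernel vector. Conversely, an integral kernel vector v is
    realized by powers of b. *)
Lemma solvable_kernel S : nontrivially_solvable_in_BS k S <-> has_kernel
  (sys_words S) int.
Proof.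
split=> [[sol [solP [x solx]]]|[v [v_ker [x vx]]]].
  have ker1 w : w \in sys_words S -> lform (fun y => (aff (sol y)).1) w = 0.
    by move=> /solP wsol; rewrite -aff_weval_fst wsol aff1.
  have [sol1|] := pselect (forall y, (aff (sol y)).1 = 0); last first.
    move=> not0; exists (fun y => (aff (sol y)).1); split=> //.
    apply: contrapT => no_y; apply: not0 => y.
    by apply: contrapT => /eqP y0; apply: no_y; exists y.
  apply: has_kernel_rat; exists (fun y => (aff (sol y)).2); split=> [w /solP wsol|].
    by rewrite -aff_weval_snd // wsol aff1.
  exists x; apply/eqP => sol2; apply: solx; apply: (aff_inj1 k_gt0).
  by rewrite [aff _]surjective_pairing sol1 sol2.
have /choice[sol affE] : forall y, exists z : BS k, aff z = (v y, 0).
  by move=> y; apply: (aff_onto k_gt0); apply: kfrac0.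
exists sol; split.
  move=> w w_in; apply: (aff_inj1 k_gt0); rewrite [aff _]surjective_pairing.
  rewrite aff_weval_snd0 => [|y]; last by rewrite affE.
  rewrite aff_weval_fst -(v_ker w w_in); congr (_, _).
  by apply: eq_bigr => l _; rewrite affE.
exists x => sol1; move: vx; have := affE x; rewrite sol1 aff1 // => -[<-].
by rewrite eqxx.
Qed.
End Systems.

(** * The decision procedure for systems *)

Definition lform_digits (N y W : nat) : nat :=
  \sum_(0 <= t < code_size W) N.-1 ^ odd (code_nth W t) * digit N y (code_nth W
    t)./2.

(** Entry 0 of the code is the number of variables and the words follow from entry 1 on. The digits
    of [y] form a candidate kernel vector modulo [kernel_modulus c]; the test is the same for all
    k. *)
Definition decide_sys (c : nat) : bool :=
  has (fun y =>
      all (fun j => kernel_modulus c %| lform_digits (kernel_modulus c) y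
        (code_nth c j.+1))
        (iota 0 (code_size c).-1) &&
      has (fun i => odd (digit (kernel_modulus c) y i)) (iota 0 (code_nth c 0)))
    (iota 0 (kernel_modulus c ^ code_nth c 0)).

Lemma crec_lform_digits n N Y W : crec n N -> crec n Y -> crec n W ->
  crec n (fun v => lform_digits (N v) (Y v) (W v)).
Proof.
move=> recN recY recW; rewrite /lform_digits.
have recL : crec n.+1 (fun u => code_nth (W (behead u)) (head 0 u)).
  by apply: crec_code_nth; crec.
apply: crec_sumb; first exact: crec_code_size.
by apply: crec_mul; [crec | apply: crec_digit; crec].
Qed.

Lemma crec_kernel_modulus n F : crec n F -> crec n (fun v => kernel_modulus (F v)).
Proof. by move=> recF; rewrite /kernel_modulus /minor_bound; crec. Qed.

Lemma crec_decide_sys : crec 1 (fun v => decide_sys (nth 0 v 0)).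
Proof.
have recC : crec 1 (fun v => nth 0 v 0) by apply: crec_var.
have recC2 : crec 2 (fun u => nth 0 (behead u) 0) by apply: (@crec_weak 1 (nth 0
  ^~ 0)).
have recC3 : crec 3 (fun u => nth 0 (behead (behead u)) 0).
  by apply: (@crec_weak2 1 (nth 0 ^~ 0)).
have rec1 : crec 3 (fun u => head 0 (behead u)).
  by apply: (@crec_weak 2 (head 0)); apply: crec_head.
rewrite /decide_sys; apply: (@crec_has 1 _ (fun y v =>
      all (fun j => kernel_modulus (nth 0 v 0) %|
          lform_digits (kernel_modulus (nth 0 v 0)) y (code_nth (nth 0 v 0) j.+1))
        (iota 0 (code_size (nth 0 v 0)).-1) &&
      has (fun i => odd (digit (kernel_modulus (nth 0 v 0)) y i))
        (iota 0 (code_nth (nth 0 v 0) 0)))).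
  apply: crec_exp; first exact: crec_kernel_modulus.
  by apply: crec_code_nth => //; apply: crec_const.
apply: crec_and.
  apply: (@crec_allb 2 _ (fun j u => kernel_modulus (nth 0 (behead u) 0) %|
    lform_digits (kernel_modulus (nth 0 (behead u) 0)) (head 0 u)
      (code_nth (nth 0 (behead u) 0) j.+1))).
    by apply: crec_pred; apply: crec_code_size.
  apply: crec_dvd; first exact: crec_kernel_modulus.
  apply: crec_lform_digits => //; first exact: crec_kernel_modulus.
  by apply: crec_code_nth => //; apply: crec_S; apply: crec_head.
apply: (@crec_has 2 _ (fun i u =>
  odd (digit (kernel_modulus (nth 0 (behead u) 0)) (head 0 u) i))).
  by apply: crec_code_nth => //; apply: crec_const.
apply: crec_odd; apply: crec_digit => //; last exact: crec_head.
exact: crec_kernel_modulus.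
Qed.

Lemma big_word_code (T : Type) (idx : T -> nat) (w : gword T) (F : nat -> nat) :
  \sum_(0 <= t < code_size (word_code idx w)) F (code_nth (word_code idx w) t) =
  \sum_(l <- w) F ((idx l.1).*2 + l.2).
Proof.
rewrite code_sizeE; under eq_bigr => t _ do rewrite code_nthE.
by rewrite -(big_nth 0 xpredT F) big_map.
Qed.

Lemma lform_digits_congr (n N y : nat) (w : gword 'I_n) (d : 'I_n -> nat) : 0 < N ->
  (forall x : 'I_n, digit N y x = d x) ->
  (N %| lform_digits N y (word_code (@nat_of_ord n) w)) =
  (N%:Z %| lform (fun x => (d x)%:Z) w)%Z.
Proof.
move=> N_gt0 yE; rewrite /lform_digits.
rewrite (big_word_code _ w (fun m => N.-1 ^ odd m * digit N y m./2)).
set S := \sum_(l <- w) _; have SE : (N%:Z %| (S%:Z - lform (fun x =>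
  (d x)%:Z) w)%R)%Z.
  rewrite {}/S /lform; elim: w => [|[x b] w IHw]; first by rewrite !big_nil dvdz0.
  rewrite !big_cons PoszD opprD addrACA rpredD //= addnC half_bit_double yE.
  rewrite oddD odd_double addbF oddb; case: b; rewrite ?mul1n ?subrr ?dvdz0 //.
  by rewrite opprK expn1 -PoszD -mulSnr prednK // dvdzE dvdn_mulr.
by rewrite -[lform _ _](subKr S%:Z) rpredBr // dvdzE.
Qed.

Lemma decide_sysP k S : 0 < k ->
  decide_sys (system_code S) <-> nontrivially_solvable_in_BS k S.
Proof.
move=> k_gt0; rewrite solvable_kernel //; set c := system_code S.
have cE0 : code_nth c 0 = sys_nvars S by rewrite /c code_nthE.
have cS j : j < size (sys_words S) -> code_nth c j.+1 =
    word_code (@nat_of_ord (sys_nvars S)) (nth [::] (sys_words S) j).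
  by move=> lt_j; rewrite /c code_nthE /= (nth_map [::]).
have c_size : (code_size c).-1 = size (sys_words S) by rewrite /c code_sizeE /=
  size_map.
have c_gt0 : 0 < c by rewrite lt0n code_eq0.
have le_nc : sys_nvars S <= c by rewrite -cE0 /c code_nthE; apply: code_gt_nth.
have size_le w : w \in sys_words S -> size w <= c.
  case/(nthP [::]) => j lt_j <-; apply: (@leq_trans (code_nth c j.+1)).
    by rewrite cS // size_le_word_code.
  by rewrite /c code_nthE; apply: code_gt_nth.
have N_gt0 : 0 < kernel_modulus c by rewrite muln_gt0 fact_gt0.
rewrite (kernel_mod c_gt0 le_nc size_le) /decide_sys cE0 c_size.
split=> [/hasP[y _ /andP[/allP y_ker /hasP[i]]]|[d [d_lt d_ker [x x_odd]]]].
  rewrite mem_iota => lt_i i_odd; exists (fun x => digit (kernel_modulus c) y x).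
  split=> [x|w|]; [exact: digit_lt | | by exists (Ordinal lt_i)].
  case/(nthP [::]) => j lt_j <-; rewrite -(lform_digits_congr (y := y)) // -cS //.
  by apply: y_ker; rewrite mem_iota.
have [y y_lt yP] := @digit_ex (kernel_modulus c) (sys_nvars S)
  (fun i => if insub i is Some x then d x else 0) (fun i _ =>
    if insub i is Some x as o return (if o is Some x then d x else 0) < _ then
      d_lt x else N_gt0).
have {}yP (x' : 'I_(sys_nvars S)) : digit (kernel_modulus c) y x' = d x'.
  by rewrite yP // valK.
apply/hasP; exists y; first by rewrite mem_iota.
apply/andP; split; last by apply/hasP; exists (val x); rewrite ?mem_iota //= yP.
apply/allP => j; rewrite mem_iota => lt_j;
  rewrite cS // (lform_digits_congr _ N_gt0 yP).
by apply: d_ker; rewrite mem_nth.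
Qed.

Lemma decidable_systems k : 0 < k ->
  algorithmically_decidable system_code (fun=> True)
    (nontrivially_solvable_in_BS k).
Proof.
move=> k_gt0; exists (fun v => decide_sys (nth 0 v 0));
  first exact: crec_decide_sys.
move=> S _ /=; have [decP Pdec] := decide_sysP S k_gt0.
by split=> [/Pdec->//|nP]; case: (decide_sys _) decP => // /(_ isT).
Qed.

Theorem theorem1 (k : nat) (hk : 1 <= k) :
  algorithmically_decidable equation_code quadratic (solvable_in_BS k) /\
  algorithmically_decidable system_code (fun _ : cf_system => True)
    (nontrivially_solvable_in_BS k).
Proof. by split; [apply: decidable_equations | apply: decidable_systems]. Qed.
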